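(* Let $\phi\colon\mathbb{R}^n\to\phi(\mathbb{R}^n)=\mathbb{R}^n$ be a homeomorphism of the form $\phi(\xi)=A(\xi)\xi$ for $\xi\in\mathbb{R}^n\setminus\{0\}$, $\phi(0)=0$, where $A\colon\mathbb{R}^n\setminus\{0\}\to(0,+\infty)$ is continuous, and let $h=h(t,x)\colon[0,T]\times\mathbb{R}^n\to\mathbb{R}^n$ be a continuous function. Let $g\colon\mathbb{R}^n\to\mathbb{R}^n$ be continuous and such that $g(y)$ has either the same or the opposite direction of $y$, i.e. for every $y\in\mathbb{R}^n$ there is $c(y)\in\mathbb{R}$ with $g(y)=c(y)\,y$. Assume also that there exists $\mathcal{G}\colon\mathbb{R}^n\to\mathbb{R}$ of class $\mathcal{C}^1$ such that the map $y\mapsto g(y)-\nabla\mathcal{G}(\phi(y))$ is bounded on $\mathbb{R}^n$. Let $V\colon\mathbb{R}^n\to\mathbb{R}$ be a $\mathcal{C}^2$-function such that $V'(u)\neq0$ for all $u\in\mathbb{R}^n$ with $V(u)=0$. Let $D:=\{x\in\mathbb{R}^n:V(x)\le0\}$ be nonempty and bounded. Suppose that for every $t\in[0,T]$ and $u\in\partial D$: - $\langle V'(u),h(t,u)\rangle\ge0$; - $\langle V''(u)y,y\rangle\ge0$ for all $y\in\mathbb{R}^n$ with $\langle V'(u),y\rangle=0$. Then the problem $$(\phi(x'))'=g(x')+h(t,x),\qquad x(0)=x(T),\quad x'(0)=x'(T)$$ has at least one solution with values in $D$.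
   Context: $T>0$ and $n\ge1$ are fixed. $\langle\cdot,\cdot\rangle$ is the standard inner product on $\mathbb{R}^n$; $V'$ denotes the gradient and $V''$ the Hessian matrix of $V$. A solution of the problem is a continuously differentiable function $x\colon[0,T]\to\mathbb{R}^n$ such that $t\mapsto\phi(x'(t))$ is continuously differentiable, the equation holds for all $t\in[0,T]$, and the boundary conditions hold. *)

(* Defs.v *)
From HB Require Import structures.
From mathcomp Require Import all_boot all_order all_algebra.
From mathcomp Require Import all_classical all_reals all_analysis.
Import Order.TTheory GRing.Theory Num.Theory.
Import numFieldNormedType.Exports.

Set Implicit Arguments.
Unset Strict Implicit.
Unset Printing Implicit Defensive.

Local Open Scope classical_set_scope.
Local Open Scope ring_scope.

(* Points of R^n are row vectors. MathComp-Analysis norms 'rV[R]_n by the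
   maximum norm: it yields the usual topology and bounded sets, and the
   Euclidean structure enters only through [dotv]. *)
Definition dotv (R : realType) (n : nat) (u v : 'rV[R]_n) : R :=
  \sum_(i < n) u 0 i * v 0 i.

Definition grad (R : realType) (n : nat) (f : 'rV[R]_n -> R) (u : 'rV[R]_n) :
    'rV[R]_n :=
  \row_(i < n) 'D_(delta_mx 0 i) f u.

(* Acts on row vectors from the right: V''(u) y is written y *m hessian V u. *)
Definition hessian (R : realType) (n : nat) (f : 'rV[R]_n -> R)
    (u : 'rV[R]_n) : 'M[R]_n :=
  'J (grad f) u.

Definition class_C1 (R : realType) (n : nat) (f : 'rV[R]_n -> R) : Prop :=
  (forall u, differentiable f u) /\ continuous (grad f).

Definition class_C2 (R : realType) (n : nat) (f : 'rV[R]_n -> R) : Prop :=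
  [/\ class_C1 f, forall u, differentiable (grad f) u & continuous (hessian f)].

Definition homeomorphism (S T : topologicalType) (f : S -> T) : Prop :=
  continuous f /\
  exists g : T -> S, [/\ cancel f g, cancel g f & continuous g].

Definition boundary (T : topologicalType) (D : set T) : set T :=
  closure D `\` interior D.

(* f is continuously differentiable on [a, b] with derivative df. The limit is
   taken inside [a, b], so it is one-sided at the endpoints and the values of f
   outside [a, b] are irrelevant. For a < b, df is unique on [a, b]. *)
Definition C1_on (R : realType) (n : nat) (a b : R) (f df : R -> 'rV[R]_n) :
    Prop :=
  (forall t, t \in `[a, b] ->
     (s - t)^-1 *: (f s - f t) @[s --> within `[a, b] t^'] --> df t) /\
  {within `[a, b], continuous df}.

Definition periodic_solution (R : realType) (n : nat) (T : R)
    (phi g : 'rV[R]_n -> 'rV[R]_n) (h : R -> 'rV[R]_n -> 'rV[R]_n)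
    (x : R -> 'rV[R]_n) : Prop :=
  exists x' w : R -> 'rV[R]_n,
    [/\ C1_on 0 T x x',
        C1_on 0 T (phi \o x') w,
        forall t, t \in `[0, T] -> w t = g (x' t) + h t (x t),
        x 0 = x T
      & x' 0 = x' T].

(* Main.v *)
Require Import Defs.
From HB Require Import structures.
From mathcomp Require Import all_boot all_order all_algebra.
From mathcomp Require Import all_classical all_reals all_analysis.
From mathcomp Require Import ring lra.
Import Order.TTheory GRing.Theory Num.Theory.
Import numFieldNormedType.Exports.
Set Implicit Arguments.
Unset Strict Implicit.
Unset Printing Implicit Defensive.

(** Write [psi] for the inverse of [phi], [w = phi(x')] for the momentum and
    [ghat = g o psi].  Since [phi(y)] is a positive multiple of [y], [psi(w)] is
    a positive multiple of [w] and [ghat(w)] a multiple of [w].  The problem is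
    the periodic first-order system [x' = psi(w)], [w' = ghat(w) + h(t, x)].

    Convexity.  The condition on [V''] makes the boundary of [D] curve the right
    way: a line cannot touch it from the inside and then enter the interior
    ([no_tangential_entry]).  Sweeping triangles, one finds that the points of
    [V < 0] visible from one of them form a convex open set.  Its closure [C] is
    compact and convex, and at a point [p] of [C] with [V(p) = 0] the normal cone
    of [C] is the ray spanned by [V'(p)] ([convex_component]).

    Discretization.  Replace the derivatives by difference quotients with step
    [d = T / N].  The discrete system is [F(x) = 0] for a continuous [F] on
    [C^N], and Brouwer's theorem, applied to a projected field, gives [x] in
    [C^N] with [<F_i(x), q - x_i> >= 0] for all [q] in [C]
    ([variational_inequality]).  If [V(x_i) = 0], both neighbours of [x_i] lie on
    the inner side of the tangent plane, and the hypothesis on [h] gives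
    [<V'(x_i), F_i(x)> >= 0], provided that [ghat(w) = k w] with [k <= 1/d]; this
    is arranged by damping the field near the origin.  As [- F_i(x)] is in the
    normal cone, [F_i(x) = 0] ([discrete_equation]).

    Limit.  When [ghat] is bounded, the discrete momenta have bounded speed, and
    they are bounded because the [psi(w_j)] add up to zero and so cannot all
    point to the side of [w_0].  The step functions converge along an
    ultrafilter to a solution with values in [C] ([bounded_problem_solution]).

    A priori bound.  In general [ghat] is first replaced by a bounded field built
    from the radial cut-off [pull], which is the identity on the ball of radius
    [sqrt S].  Because [ghat] is radial and close to [grad G], the derivative of
    [E = G(pull(w))] is at least [|w'|^2 - c |w'| >= c |w'| - c^2], where [c]
    does not depend on [S] ([energy_derive], [energy_monotone]).  Periodicity
    then bounds the oscillation of [w] by [c T / 2], and [w] itself by [c T]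
    since [x'] is orthogonal to [w(0)] at some time ([momentum_bound]).  For
    [S >= (c T)^2] the cut-off is not active on the solution.

    Brouwer's theorem itself comes from Scarf's lemma, the purely ordinal form
    of Sperner's lemma: it needs no triangulation. *)

(** * Scarf's lemma *)

Module Scarf.
Import mathcomp.boot.ssrnat mathcomp.boot.fintype mathcomp.boot.finset.
Local Open Scope nat_scope.

Lemma imset_collision (A B : finType) (f : A -> B) (S : {set A}) :
  #|f @: S| < #|S| -> exists x y, [/\ x \in S, y \in S, x != y & f x = f y].
Proof.
move=> lt; have : ~~ dinjectiveb f (mem S).
  apply/negP => /dinjectiveP inj; move: lt.
  by rewrite card_in_imset ?ltnn // => x y xS yS; apply: inj.
move=> /dinjectivePn[x xS [y /andP[yx yS] exy]].
by exists x, y; split=> //; rewrite eq_sym.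
Qed.

(** Exactly one fibre has two elements; these two are the ones that may go. *)
Lemma card_removable (A B : finType) (f : A -> B) (S : {set A}) (E : {set B}) :
  f @: S = E -> #|S| = #|E|.+1 ->
  #|[set x in S | f @: (S :\ x) == E]| = 2.
Proof.
move=> fS cS.
have [x [y [xS yS xy fxy]]] : exists x y,
    [/\ x \in S, y \in S, x != y & f x = f y].
  by apply: imset_collision; rewrite fS cS.
have rem u v : u \in S -> v \in S -> u != v -> f u = f v -> f @: (S :\ u) == E.
  move=> uS vS uv fuv; rewrite -fS eqEsubset imsetS ?subsetDl //=.
  apply/subsetP => _ /imsetP[w wS ->]; have [->|wu] := eqVneq w u.
    by rewrite fuv imset_f // !inE eq_sym uv.
  by rewrite imset_f // !inE wu.
suff -> : [set z in S | f @: (S :\ z) == E] = [set x; y] by rewrite cards2 xy.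
apply/setP => z; rewrite !inE; apply/andP/orP; last first.
  by move=> [/eqP->|/eqP->]; split=> //;
     [exact: rem fxy | apply: rem (esym fxy) => //; rewrite eq_sym].
move=> [zS /eqP fz]; have [->|zx] := eqVneq z x; first by left.
right; apply/negPn/negP => zy.
have /imset_injP inj : #|f @: (S :\ z)| == #|S :\ z|.
  by rewrite fz; move: cS; rewrite (cardsD1 z) zS add1n => -[->].
by move/eqP: xy; apply; apply: inj; rewrite ?inE ?xS ?yS 1?eq_sym ?zx ?zy.
Qed.

Lemma odd_sumP (A : finType) (P : pred A) (F : A -> nat) :
  odd (\sum_(i | P i) F i) -> exists2 i, P i & odd (F i).
Proof.
move=> oS; apply/exists_inP; apply: contraLR oS => /exists_inPn H.
elim/big_rec: _ => // i n Pi; rewrite oddD => /negPf ->.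
by rewrite addbF; exact: H.
Qed.

Section Scarf.
Variables (I T : finType) (rk : I -> T -> nat).
Hypothesis rk_inj : forall i, injective (rk i).

Definition lowest (i : I) (s : {set T}) (y : T) : bool :=
  [forall x in s, rk i y <= rk i x].

(** No point of [T] lies above all of [s] in every ordering of [C].  Cells and
    doors, the dominant pairs with [#|C| = #|s|] and [#|C| = #|s| + 1], play the
    parts of the simplices and facets of a triangulation. *)
Definition dominant (s : {set T}) (C : {set I}) : bool :=
  [forall y, [exists i in C, lowest i s y]].

Definition cell (p : {set T} * {set I}) : bool :=
  dominant p.1 p.2 && (#|p.1| == #|p.2|).

Definition door (p : {set T} * {set I}) : bool :=
  dominant p.1 p.2 && (#|p.2| == #|p.1|.+1).

Definition opens (d p : {set T} * {set I}) : bool :=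
  (d.1 \subset p.1) && (p.2 \subset d.2).

Lemma dominantP (s : {set T}) (C : {set I}) :
  reflect (forall y, exists2 i, i \in C & forall x, x \in s -> rk i y <= rk i x)
          (dominant s C).
Proof.
apply: (iffP forallP) => H y.
  by have /exists_inP[i iC /forall_inP] := H y; exists i.
by have [i iC hi] := H y; apply/exists_inP; exists i => //; apply/forall_inP.
Qed.

Lemma opens_split d p : door d -> cell p ->
  opens d p = [exists i in d.2, p == (d.1, d.2 :\ i)]
           || [exists x in ~: d.1, p == (x |: d.1, d.2)].
Proof.
case: d p => t D [s C] /andP[_ /eqP /= cD] /andP[_ /eqP /= cC].
apply/andP/orP => /= [[ts CD]|]; last first.
  case=> [/exists_inP[i iD /eqP[-> ->]]|/exists_inP[x xD /eqP[-> ->]]].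
    by rewrite subxx subsetDl.
  by rewrite subxx subsetUr.
have := subset_leq_card ts; rewrite leq_eqVlt => /orP[/eqP e|lt].
  have {ts} et : t = s by apply/eqP; rewrite eqEcard ts e leqnn.
  have : #|D :\: C| == 1 by rewrite cardsD (setIidPr CD) cD -cC -e subSnn.
  move=> /cards1P[i eD]; have : i \in D :\: C by rewrite eD set11.
  rewrite inE => /andP[iC iD]; left; apply/exists_inP; exists i => //.
  by rewrite et -eD setDDr setDv set0U (setIidPr CD).
have eC : C = D by apply/eqP; rewrite eqEcard CD cD -cC.
have : #|s :\: t| == 1 by rewrite cardsD (setIidPr ts) cC eC cD subSnn.
move=> /cards1P[x es]; have : x \in s :\: t by rewrite es set11.
rewrite inE => /andP[xt xs]; right; apply/exists_inP; exists x; rewrite ?inE //.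
by rewrite eC -es setUC -{1}(setIidPr ts) setID.
Qed.

Section Doors.
Variables (t : {set T}) (D : {set I}) (z0 : T).
Hypotheses (dom : dominant t D) (cD : #|D| = #|t|.+1).

Let low i : T := [arg min_(x < z0 in t) rk i x].
Let free i : {set T} :=
  [set y | [forall (j | j \in D :\ i), ~~ lowest j t y]].
Let adj i : {set T} * {set I} :=
  if [pick y in free i] is Some y
  then ([arg max_(x > y in free i) rk i x] |: t, D) else (t, D :\ i).

(** Every point of [t] is the [i]-lowest one for some [i] in [D], so exactly one
    of them is so for two indices.  Each of these two indices [i] yields one cell:
    drop [i] from [D] or, if that leaves some points free, add to [t] the
    [i]-highest free point. *)
Lemma card_cells_of_door : z0 \in t ->
  #|[set p | cell p && opens (t, D) p]| = 2.
Proof.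
move=> z0t.
have lowP i : low i \in t /\ forall x, x \in t -> rk i (low i) <= rk i x.
  by rewrite /low; case: arg_minnP => // x xt H; split.
have lowE i z : z \in t -> lowest i t z -> low i = z.
  move=> zt /forall_inP zl; apply: (@rk_inj i); apply/eqP.
  by have [lt ll] := lowP i; rewrite eqn_leq zl // ll.
have lowD : low @: D = t.
  apply/eqP; rewrite eqEsubset; apply/andP; split; apply/subsetP.
    by move=> _ /imsetP[i _ ->]; case: (lowP i).
  move=> z zt; have /forallP/(_ z)/exists_inP[i iD zl] := dom.
  by rewrite -(lowE i z zt zl) imset_f.
pose R := [set i in D | low @: (D :\ i) == t].
have freeP i y : reflect (forall j, j \in D -> j != i -> ~~ lowest j t y)
    (y \in free i).
  rewrite inE; apply: (iffP forall_inP) => H j.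
    by move=> jD ji; apply: H; rewrite !inE ji.
  by rewrite !inE => /andP[ji jD]; apply: H.
have free_low i y : i \in R -> y \in free i -> (y \notin t) /\ lowest i t y.
  rewrite inE => /andP[iD /eqP lowDi] /freeP yF; split.
    apply/negP => yt; move: (yt); rewrite -lowDi => /imsetP[j].
    rewrite !inE => /andP[ji jD] ey; move/negP: (yF j jD ji); apply.
    by apply/forall_inP => x; rewrite ey; apply: (lowP j).2.
  have /forallP/(_ y)/exists_inP[j jD yl] := dom.
  by have [<-//|ji] := eqVneq j i; rewrite (negPf (yF _ jD ji)) in yl.
have adjP i : i \in R ->
    (forall y, y \notin free i) /\ adj i = (t, D :\ i) \/
    exists x, [/\ x \in free i, forall y, y \in free i -> rk i y <= rk i x
                & adj i = (x |: t, D)].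
  move=> iR; rewrite /adj; case: pickP => [y yF|F0]; last first.
    by left; split=> // y; rewrite F0.
  by right; case: arg_maxnP => // x xF xM; exists x.
suff -> : [set p | cell p && opens (t, D) p] = adj @: R.
  rewrite card_in_imset ?card_removable // => i j iR jR.
  case: (adjP i iR) => [[_ ->]|[x [xF _ ->]]];
    case: (adjP j jR) => [[_ ->]|[x' [xF' _ ->]]].
  - move=> [e]; apply/eqP/negPn/negP => ij.
    have : i \in D :\ i by rewrite e !inE ij; move: iR; rewrite inE => /andP[].
    by rewrite !inE eqxx.
  - move=> [e _]; have [/negP[]] := free_low j x' jR xF'.
    by rewrite e setU11.
  - move=> [e _]; have [/negP[]] := free_low i x iR xF.
    by rewrite -e setU11.
  - move=> [e]; have [xt _] := free_low i x iR xF.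
    have [_ l'] := free_low j x' jR xF'.
    have exx : x = x'.
      have : x \in x' |: t by rewrite -e setU11.
      by rewrite !inE (negPf xt) orbF => /eqP.
    apply/eqP/negPn/negP => ij; move: iR jR; rewrite !inE => /andP[iD _] /andP[jD _].
    move/freeP: xF => /(_ j jD); rewrite eq_sym ij exx l' => /(_ isT).
    by [].
apply/setP => p; rewrite inE; apply/andP/imsetP.
  move=> [cp op]; move: (cp) => /andP[/dominantP pdom /eqP cardp].
  move: op; rewrite opens_split //; last by rewrite /door dom cD eqxx.
  case/orP => /exists_inP /= [].
    move=> i iD /eqP ep; rewrite ep /= in pdom cardp.
    have iR : i \in R.
      rewrite inE iD eqEsubset /=; apply/andP; split; apply/subsetP => z.
        by move=> /imsetP[j _ ->]; case: (lowP j).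
      move=> zt; have [j jD /forall_inP zl] := pdom z.
      by rewrite -(lowE j z zt zl) imset_f.
    exists i => //; rewrite ep; case: (adjP i iR) => [[_ ->//]|[x [/freeP xF _ _]]].
    have [j /setD1P[ji jD] /forall_inP xl] := pdom x.
    by move/negP: (xF j jD ji).
  move=> x; rewrite inE => xt /eqP ep; rewrite ep /= in pdom cardp.
  have [i iD xl] := pdom x.
  have notx z j : z \in t -> (forall y, y \in x |: t -> rk j z <= rk j y) ->
     (forall y, y \in x |: t -> rk j x <= rk j y) -> False.
    move=> zt lz lx; move/negP: xt; apply.
    suff -> : x = z by [].
    apply: (@rk_inj j); apply/eqP; rewrite eqn_leq lx ?lz ?setU11 //.
    by rewrite inE zt orbT.
  have iR : i \in R.
    rewrite inE iD eqEsubset /=; apply/andP; split; apply/subsetP => z.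
      by move=> /imsetP[j _ ->]; case: (lowP j).
    move=> zt; have [j jD zl] := pdom z.
    have ji : j != i by apply/eqP => ej; rewrite ej in zl; exact: (notx z i).
    rewrite -(lowE j z zt) ?imset_f ?inE ?ji //.
    by apply/forall_inP => y yt; apply: zl; rewrite inE yt orbT.
  have xF : x \in free i.
    apply/freeP => j jD ji; apply/negP => /forall_inP xj.
    (* two indices attaining the minimum at x would leave too few for t *)
    have : #|t| <= #|D :\ i :\ j|.
      apply: leq_trans (leq_imset_card low _); apply: subset_leq_card.
      apply/subsetP => z zt; have [k kD zl] := pdom z.
      have ki : k != i by apply/eqP => ej; rewrite ej in zl; exact: (notx z i).
      have kj : k != j.
        apply/eqP => ej; rewrite ej in zl; apply: (notx z j) => // y.
        by rewrite !inE => /orP[/eqP->//|]; exact: xj.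
      rewrite -(lowE k z zt) ?imset_f ?inE ?ki ?kj //.
      by apply/forall_inP => y yt; apply: zl; rewrite inE yt orbT.
    have := cardsD1 i D; rewrite iD cD add1n => -[->].
    have := cardsD1 j (D :\ i); rewrite !inE ji jD add1n => ->.
    by rewrite ltnn.
  exists i => //; rewrite ep; case: (adjP i iR) => [[/(_ x)]|[x' [xF' xM ->]]].
    by rewrite xF.
  congr (_ |: _, _); apply: (@rk_inj i); apply/eqP.
  rewrite eqn_leq xM //=; have [j jD xl'] := pdom x'.
  have [<-|ji] := eqVneq j i; first by rewrite xl' ?setU11.
  move/freeP: xF' => /(_ j jD ji) /negP[]; apply/forall_inP => y yt.
  by apply: xl'; rewrite inE yt orbT.
move=> [i iR ->]; have iD : i \in D by move: (iR); rewrite inE => /andP[].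
have dD : door (t, D) by rewrite /door dom cD eqxx.
suff ca : cell (adj i).
  split=> //; rewrite opens_split //; apply/orP.
  case: (adjP i iR) => [[_ ->]|[x [xF _ ->]]]; [left|right]; apply/exists_inP.
    by exists i.
  by exists x => //; rewrite inE; case: (free_low i x iR xF).
case: (adjP i iR) => [[F0 ->]|[x [xF xM ->]]].
  apply/andP; split; last first.
    by move: cD; rewrite (cardsD1 i) iD add1n => -[->].
  apply/dominantP => y /=; move: (F0 y); rewrite inE => /forall_inPn[j jD].
  by rewrite negbK => /forall_inP jl; exists j.
have [xt /forall_inP xl] := free_low i x iR xF.
apply/andP; split; last by rewrite /= cardsU1 xt cD.
apply/dominantP => y /=; have [yF|] := boolP (y \in free i).
  exists i => // z; rewrite !inE => /orP[/eqP->|zt]; first exact: xM.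
  exact: leq_trans (xM _ yF) (xl _ zt).
rewrite inE => /forall_inPn[j jD]; rewrite negbK => /forall_inP jl.
move: jD; rewrite !inE => /andP[ji jD]; exists j => // z.
rewrite !inE => /orP[/eqP->|]; last exact: jl.
move/freeP: xF => /(_ j jD ji) /forall_inPn[w wt].
rewrite -ltnNge => /ltnW; exact: leq_trans (jl _ wt).
Qed.

End Doors.

Section Colouring.
Variables (c : T -> I) (i0 : I).

(** The doors of a pivoting path, on which [i0] is the only missing colour. *)
Definition typed (d : {set T} * {set I}) : bool :=
  [&& door d, i0 \in d.2 & c @: d.1 == d.2 :\ i0].

(** A cell that misses only [i0] repeats one colour, and either copy may be
    removed.  If the colours are [C] without [i0] but with a foreign colour [j],
    one door removes the point coloured [j] and another one adds [j] to [C].  In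
    all other cases there is no door. *)
Lemma even_doors_of_cell p : cell p -> c @: p.1 != p.2 ->
  ~~ odd #|[set d | typed d && opens d p]|.
Proof.
case: p => s C cp /= ncol.
move: (cp) => /andP[/= pdom /eqP /= csC].
have domS (t : {set T}) (D : {set I}) : t \subset s -> C \subset D -> dominant t D.
  move=> ts CD; apply/dominantP => y; have /dominantP/(_ y)[i iC il] := pdom.
  exists i; first exact: (subsetP CD).
  by move=> x xt; apply: il; apply: (subsetP ts).
pose A := [set x in s | (i0 \in C) && (c @: (s :\ x) == C :\ i0)].
pose B := [set j in ~: C | (i0 \in j |: C) && (c @: s == (j |: C) :\ i0)].
have -> : [set d | typed d && opens d (s, C)] =
    [set (s :\ x, C) | x in A] :|: [set (s, j |: C) | j in B].
  apply/setP => d; rewrite in_setU inE; apply/andP/orP.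
    move=> [/and3P[dd i0d cd] od]; move: od.
    case: d dd i0d cd => t D /= dd i0D /eqP cd.
    rewrite opens_split //= => /orP[/exists_inP[i iD /eqP[es eC]]|
                                    /exists_inP[x xt /eqP[es eC]]].
      right; apply/imsetP; exists i; last by rewrite eC setD1K // es.
      by rewrite in_set in_setC eC setD1K // i0D es cd setD11 eqxx.
    left; apply/imsetP; exists x; last by rewrite eC es setU1K // -in_setC.
    by rewrite !inE es setU11 setU1K -?in_setC // eC i0D cd eqxx.
  have doorA x : x \in s -> door (s :\ x, C).
    move=> xs; rewrite /door /= domS ?subsetDl //=.
    by rewrite -csC (cardsD1 x s) xs.
  have doorB j : j \notin C -> door (s, j |: C).
    by move=> jC; rewrite /door /= domS ?subsetUr //= cardsU1 jC csC.
  case=> /imsetP[x]; rewrite !inE => /and3P[xs i0C ex] ->.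
    by rewrite /typed doorA //= i0C ex /opens /= subsetDl subxx.
  by rewrite /typed doorB //= ex /opens /= subsetUr subxx !inE i0C.
have disj : [disjoint [set (s :\ x, C) | x in A] & [set (s, j |: C) | j in B]].
  apply/pred0P => d /=; apply/negP => /andP[/imsetP[x xA ->]].
  move=> /imsetP[j jB [es eC]]; move: xA; rewrite inE => /andP[].
  by rewrite -{1}es !inE eqxx.
rewrite cardsU disjoint_setI0 // cards0 subn0.
rewrite !card_in_imset; first last.
- move=> x y; rewrite inE => /andP[xs _]; rewrite inE => /andP[ys _] [e].
  apply/eqP/negPn/negP => xy; have : x \in s :\ y by rewrite !inE xy.
  by rewrite -e !inE eqxx.
- move=> x y; rewrite inE => /andP[+ _]; rewrite inE => xC.
  rewrite inE => /andP[_ _] [e]; have : x \in y |: C by rewrite -e setU11.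
  by rewrite !inE (negPf xC) orbF => /eqP.
have [i0C|i0C] := boolP (i0 \in C); last first.
  have -> : A = set0 by apply/setP => x; rewrite !inE (negPf i0C) /= andbF.
  suff -> : B = set0 by rewrite !cards0.
  apply/setP => j; rewrite !inE; apply/negP => /and3P[jC].
  rewrite (negPf i0C) orbF => /eqP <-; rewrite setU1K // => /eqP e.
  by rewrite e eqxx in ncol.
have cE : #|C| = #|C :\ i0|.+1 by rewrite (cardsD1 i0 C) i0C.
have [j jC|noj] := pickP [pred j | (j \notin C) && (c @: s == j |: (C :\ i0))].
  case/andP: jC => jC /eqP ej.
  have ji0 : j != i0 by apply: contraNneq jC => ->.
  have inj : {in s &, injective c}.
    apply/imset_injP; rewrite ej cardsU1 !inE (negPf jC) andbF /= csC cE.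
    by rewrite add1n.
  have -> : B = [set j].
    apply/setP => k; rewrite !inE i0C orbT /= ej; apply/andP/eqP => [[kC /eqP e]|->].
      have : j \in (k |: C) :\ i0 by rewrite -e setU11.
      by rewrite !inE (negPf jC) orbF => /andP[_ /eqP].
    split=> //; apply/eqP/setP => l; rewrite !inE.
    by have [->|//] := eqVneq l j; rewrite ji0.
  have : j \in c @: s by rewrite ej setU11.
  move=> /imsetP[x xs ejx].
  suff -> : A = [set x] by rewrite !cards1.
  apply/setP => y; rewrite !inE i0C /=; apply/andP/eqP => [[ys /eqP e]|->].
    apply: inj => //; apply/eqP/negPn/negP => cyx.
    have : c x \in C :\ i0.
      by rewrite -e imset_f // !inE xs andbT; apply: contra cyx => /eqP->.
    by rewrite -ejx !inE (negPf jC) andbF.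
  split=> //; apply/eqP.
  have jE : j \notin C :\ i0 by rewrite !inE (negPf jC) andbF.
  rewrite -(setU1K jE) -ej; apply/setP => l; rewrite !inE; apply/imsetP/andP.
    move=> [z]; rewrite !inE => /andP[zx zs] ->; split; last by rewrite imset_f.
    by rewrite ejx; apply: contra zx => /eqP /inj ->.
  move=> [lj /imsetP[z zs el]]; exists z => //; rewrite !inE zs andbT.
  by apply: contra lj => /eqP zx; rewrite el zx ejx.
have -> : B = set0.
  apply/setP => j; rewrite !inE; apply/negP => /and3P[jC _ /eqP e].
  move: (noj j); rewrite /= jC /= e => /eqP; apply; apply/setP => l; rewrite !inE.
  have [->|//] := eqVneq l j; rewrite andbT /=; apply/eqP => ej.
  by rewrite ej i0C in jC.
rewrite cards0 addn0; have [ecs|ncs] := eqVneq (c @: s) (C :\ i0).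
  suff -> : A = [set x in s | c @: (s :\ x) == C :\ i0].
    by rewrite (card_removable ecs) // csC.
  by apply/setP => x; rewrite !inE i0C.
suff -> : A = set0 by rewrite cards0.
apply/setP => x; rewrite !inE i0C /=; apply/negP => /andP[xs /eqP e].
have ecs : c @: s = c x |: (C :\ i0) by rewrite -e -imsetU1 setD1K.
have [cxC|cxC] := boolP (c x \in C); last first.
  by move: (noj (c x)); rewrite /= cxC ecs eqxx.
have [cx0|cx0] := eqVneq (c x) i0.
  by move/eqP: ncol; apply; rewrite ecs cx0 setD1K.
move/eqP: ncs; apply; rewrite ecs; apply/setP => l; rewrite !inE.
by have [->|//] := eqVneq l (c x); rewrite cx0 cxC.
Qed.

(** Without points, a cell behind the door can only arise by adding the
    [i0]-highest point: dropping [i0] leaves no ordering at all. *)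
Lemma card_cells_of_outer_door (z0 : T) :
  #|[set p | cell p && opens (set0, [set i0]) p]| = 1.
Proof.
set d := (set0, [set i0]).
have dd : door d.
  rewrite /door /= cards1 cards0 andbT; apply/dominantP => y; exists i0.
    exact: set11.
  by move=> x; rewrite inE.
pose m := [arg max_(x > z0) rk i0 x].
have mM x : rk i0 x <= rk i0 m by rewrite /m; case: arg_maxnP => // ? _; apply.
have cm : cell ([set m], [set i0]).
  rewrite /cell /= !cards1 eqxx andbT; apply/dominantP => y; exists i0.
    exact: set11.
  by move=> x; rewrite inE => /eqP->.
apply/eqP/cards1P; exists ([set m], [set i0]); apply/setP => p; rewrite !inE.
apply/andP/eqP => [[cp]|->]; last first.
  split=> //; rewrite opens_split //; apply/orP; right; apply/exists_inP.
  by exists m; rewrite ?inE //= setU0.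
rewrite opens_split // => /orP[] /exists_inP /= [].
  move=> i; rewrite inE => /eqP-> /eqP ep; rewrite ep setDv in cp.
  by case/andP: cp => /= /dominantP/(_ z0)[j]; rewrite inE.
move=> x _ /eqP; rewrite setU0 => ep; rewrite ep; congr ([set _], _).
move: cp; rewrite ep => /andP[/= /dominantP/(_ m)[j]]; rewrite inE => /eqP-> H _.
by apply: (@rk_inj i0); apply/eqP; rewrite eqn_leq mM H ?set11.
Qed.

(** Count the pairs of a door and a cell modulo 2: every door has two cells except
    the outer one, hence some cell has an odd number of doors. *)
Theorem scarf (z0 : T) : exists s C, [/\ dominant s C, #|s| = #|C| & c @: s = C].
Proof.
pose d0 : {set T} * {set I} := (set0, [set i0]).
have td0 : typed d0.
  rewrite /typed /d0 /= set11 imset0 setDv eqxx andbT /door /= cards1 cards0 eqxx !andbT.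
  by apply/dominantP => y; exists i0; rewrite ?set11 // => x; rewrite inE.
have : odd (\sum_(p | cell p) #|[set d | typed d && opens d p]|).
  have -> : \sum_(p | cell p) #|[set d | typed d && opens d p]| =
     \sum_(d | typed d) #|[set p | cell p && opens d p]|.
    under eq_bigr do rewrite -sum1dep_card.
    rewrite (exchange_big_dep typed) /=; last by move=> p d _ /andP[].
    apply: eq_bigr => d td; rewrite -sum1dep_card.
    by apply: eq_bigl => p; rewrite td.
  rewrite (bigD1 d0) //= card_cells_of_outer_door // oddD /=.
  apply/negP => /odd_sumP[[t D] /andP[/and3P[/= /andP[/= tdom /eqP cD] iD /eqP ct] nd]].
  have [t0|[z zt]] := set_0Vmem t.
    move/eqP: nd => nd _; apply: nd; rewrite /d0 t0; congr (_, _).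
    by move: ct; rewrite t0 imset0 => /esym/eqP; rewrite setD_eq0 subset1
       => /orP[/eqP//|/eqP D0]; rewrite D0 inE in iD.
  by rewrite (card_cells_of_door tdom cD zt).
move=> /odd_sumP[[s C] cp od]; exists s, C.
have [/= dom /eqP cs] := andP cp; split=> //.
by apply/eqP; apply: contraLR od => /(even_doors_of_cell cp).
Qed.

End Colouring.
End Scarf.

(** Scarf's lemma for the lattice points of a simplex, ordered by each of their
    coordinates.  By dominance the minima [m i] over the cell, all raised by one,
    exceed the total [k]; since the coordinates of each point add up to [k], they
    stay within [#|I|] of these minima, and within [#|I|] of zero off [C]. *)
Lemma rainbow_grid_points (I : finType) (i0 : I) (k : nat)
    (c : (I -> nat) -> I) :
  exists (C : {set I}) (b : I -> I -> nat),
  [/\ C != set0,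
      forall i, i \in C -> \sum_l b i l = k /\ c (b i) = i,
      forall i j l, i \in C -> j \in C -> b i l <= b j l + #|I|
    & forall i l, i \in C -> l \notin C -> b i l <= #|I|].
Proof.
pose pt (a : {ffun I -> 'I_k.+1}) (l : I) : nat := a l.
pose T := {a : {ffun I -> 'I_k.+1} | \sum_l a l == k}.
(* the enumeration rank breaks ties between equal coordinates *)
pose rk (i : I) (a : T) : nat := val a i * #|{: T}| + enum_rank a.
have rk_lt i (a b : T) : val a i < val b i -> rk i a < rk i b.
  move=> ab; rewrite /rk; have : enum_rank a < #|{: T}| := ltn_ord _.
  move: (nat_of_ord (enum_rank a)) (nat_of_ord (enum_rank b)) => ra rb ra_lt.
  have : (val a i).+1 * #|{: T}| <= val b i * #|{: T}| by rewrite leq_mul2r ab orbT.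
  rewrite mulSn => le_ab; apply: leq_trans (leq_addr rb _); apply: leq_trans le_ab.
  by rewrite addnC ltn_add2r.
have rk_inj i : injective (rk i).
  move=> a b e; have eab : val a i = val b i :> nat.
    case: (ltngtP (val a i) (val b i)) => // /(rk_lt i); by rewrite e ltnn.
  move: e; rewrite /rk eab => /addnI e.
  by apply: enum_rank_inj; apply: val_inj.
have rk_le i a b : rk i a <= rk i b -> val a i <= val b i.
  by move=> ab; rewrite leqNgt; apply/negP => /(rk_lt i); rewrite ltnNge ab.
pose z0v : {ffun I -> 'I_k.+1} := [ffun l => inord (if l == i0 then k else 0)].
have z0P : \sum_l z0v l == k.
  rewrite (bigD1 i0) //= ffunE eqxx inordK // big1 ?addn0 // => l /negPf li.
  by rewrite ffunE li inordK.
pose z0 : T := Sub z0v z0P.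
have [s [C [/dominantP dom cs eC]]] := scarf rk_inj (fun a : T => c (pt (val a))) i0 z0.
have [i1 i1C _] := dom z0.
have C0 : C != set0 by apply/set0Pn; exists i1.
have [x0 x0s] : exists x, x \in s.
  by apply/set0Pn; rewrite -card_gt0 cs card_gt0.
pose m i := val [arg min_(x < x0 in s) val x i] i.
have m_le i x : x \in s -> m i <= val x i.
  by move=> xs; rewrite /m; case: arg_minnP => // y _; apply.
have mE i : exists2 x, x \in s & val x i = m i.
  by rewrite /m; case: arg_minnP => // y ys _; exists y.
have msum : k < \sum_(i in C) (m i).+1.
  rewrite ltnNge; apply/negP => le_k.
  pose r := k - \sum_(i in C) (m i).+1.
  pose yv i := if i \in C then (m i).+1 + (if i == i1 then r else 0) else 0.
  have yvS : \sum_i yv i = k.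
    rewrite /yv -big_mkcond /= big_split /= [X in _ + X](bigD1 i1) //= eqxx.
    rewrite [X in r + X]big1 ?addn0 => [|i /andP[_ /negPf->]//].
    by rewrite /r subnKC.
  have yv_le i : yv i < k.+1 by rewrite ltnS -yvS (bigD1 i) //= leq_addr.
  pose y : {ffun I -> 'I_k.+1} := [ffun l => inord (yv l)].
  have yP : \sum_l y l == k.
    by apply/eqP; rewrite -[RHS]yvS; apply: eq_bigr => i _; rewrite ffunE inordK.
  have [i iC il] := dom (Sub y yP); have [x xs xi] := mE i.
  have := rk_le _ _ _ (il x xs); rewrite /= xi ffunE inordK // /yv iC.
  by rewrite addSn ltnNge leq_addr.
have tot (x : T) : \sum_l val x l = k by apply/eqP; exact: (valP x).
have msum' : k < \sum_(i in C) m i + #|I|.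
  apply: leq_trans msum _; under eq_bigr do rewrite -addn1.
  by rewrite big_split /= sum1_card leq_add2l max_card.
have le_sum (P : pred I) x : x \in s -> \sum_(i | P i) m i <= \sum_(i | P i) val x i.
  by move=> xs; apply: leq_sum => i _; exact: m_le.
have far x l : x \in s -> l \notin C -> val x l <= #|I|.
  move=> xs lC; rewrite -(leq_add2l (\sum_(i in C) m i)).
  apply: leq_trans (ltnW msum'); rewrite -[X in _ <= X](tot x) [X in _ <= X](bigID (mem C)) /=.
  by rewrite leq_add ?le_sum // (bigD1 l) //= leq_addr.
have near x l : x \in s -> l \in C -> val x l <= m l + #|I|.
  move=> xs lC; rewrite -(leq_add2r (\sum_(i in C | i != l) m i)).
  rewrite addnAC -(bigD1 l) //=; apply: leq_trans (ltnW msum').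
  rewrite -[X in _ <= X](tot x) [X in _ <= X](bigID (mem C)) /=.
  rewrite [X in _ <= X + _](bigD1 l) //= -addnA.
  by rewrite leq_add2l (leq_trans (le_sum _ _ xs)) // leq_addr.
pose b i := if [pick x in s | c (pt (val x)) == i] is Some x then pt (val x) else pt (val x0).
have bP i : i \in C -> exists x, [/\ x \in s, b i = pt (val x) & c (pt (val x)) = i].
  rewrite -eC => /imsetP[y ys ei]; rewrite /b; case: pickP => [x /andP[xs /eqP cx]|].
    by exists x.
  by move/(_ y); rewrite ys ei eqxx.
exists C, b; split=> //.
- by move=> i /bP[x [xs -> cx]]; rewrite tot.
- move=> i j l /bP[x [xs -> _]] /bP[y [ys -> _]]; have [lC|lC] := boolP (l \in C).
    by apply: leq_trans (near _ _ xs lC) _; rewrite leq_add2r m_le.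
  exact: leq_trans (far _ _ xs lC) (leq_addl _ _).
- by move=> i l /bP[x [xs -> _]]; exact: far.
Qed.

End Scarf.

Local Open Scope classical_set_scope.
Local Open Scope ring_scope.

(** * Convergence of matrices and ultralimits *)

Section Matrices.
Context {R : realType} {p q : nat}.
Implicit Types M : 'M[R]_(p, q).

Lemma entry_le_norm M i j : `|M i j| <= `|M|.
Proof.
rewrite /Num.norm /= mx_normrE.
exact: (le_bigmax _ (fun ij => `|M ij.1 ij.2|) (i, j)).
Qed.

Lemma norm_le_entries M (e : R) : 0 <= e ->
  (forall i j, `|M i j| <= e) -> `|M| <= e.
Proof.
move=> e0 Me; rewrite /Num.norm /= mx_normrE.
by apply/bigmax_leP; split=> // -[i j] _; exact: Me.
Qed.

Lemma cvg_entries (S : Type) (F : set_system S) {FF : Filter F}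
    (f : S -> 'M[R]_(p, q)) M :
  (forall i j, f x i j @[x --> F] --> M i j) -> f x @[x --> F] --> M.
Proof.
move=> fM; apply/cvgrPdist_le => e e0.
have : \forall x \near F, forall ij : 'I_p * 'I_q,
    `|M ij.1 ij.2 - f x ij.1 ij.2| <= e.
  by apply: filter_forall => -[i j] /=; move/cvgrPdist_le: (fM i j); exact.
apply: filterS => x H; apply: norm_le_entries => [|i j]; first exact: ltW.
by rewrite !mxE; exact: H (i, j).
Qed.

Lemma continuous_entries (S : topologicalType) (f : S -> 'M[R]_(p, q)) :
  (forall i j, continuous (fun x => f x i j)) -> continuous f.
Proof. by move=> cf x; apply: cvg_entries => i j; exact: cf. Qed.

Lemma cvg_entry (S : Type) (F : set_system S) {FF : Filter F}
    (f : S -> 'M[R]_(p, q)) M i j :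
  f x @[x --> F] --> M -> f x i j @[x --> F] --> M i j.
Proof.
move=> fM; apply: (cvg_comp _ (fun N : 'M[R]_(p, q) => N i j) fM).
exact: coord_continuous.
Qed.

End Matrices.

Section Ultralimits.
Context {R : realType} {S : Type} (U : set_system S) {UU : UltraFilter U}.

Lemma ultra_cvg_bounded (f : S -> R) (B : R) :
  (\forall x \near U, `|f x| <= B) -> exists l : R, f x @[x --> U] --> l.
Proof.
move=> fB; have UF : UltraFilter (fmap f U).
  have PU := @ultra_proper _ _ UU.
  split; first exact: fmap_proper_filter.
  move=> G PG UG; apply/seteqP; split=> // A GA.
  have [//|UnA] := in_ultra_setVsetC (f @^-1` A) UU.
  have : G (A `&` ~` A) by apply: filterI => //; exact: UG.
  by rewrite setICr => /filter_ex[].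
have := @segment_compact R (- B) B; rewrite compact_ultra => /(_ _ UF) [].
  by apply: filterS fB => x; rewrite /= in_itv /= ler_norml.
by move=> l [_ fl]; exists l.
Qed.

Lemma ultra_cvg_bounded_mx {p q : nat} (f : S -> 'M[R]_(p, q)) (B : R) :
  (\forall x \near U, `|f x| <= B) -> exists l : 'M[R]_(p, q), f x @[x --> U] --> l.
Proof.
move=> fB; have PU := @ultra_proper _ _ UU.
have H (ij : 'I_p * 'I_q) : {l : R | f x ij.1 ij.2 @[x --> U] --> l}.
  apply: cid; apply: (@ultra_cvg_bounded _ B); apply: filterS fB => x.
  exact/le_trans/entry_le_norm.
exists (\matrix_(i, j) projT1 (H (i, j))); apply: cvg_entries => i j.
by rewrite mxE; case: (H (i, j)).
Qed.

End Ultralimits.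

(** Limits along such a [U] replace the extraction of convergent subsequences. *)
Lemma ultra_oo : exists2 U : set_system nat, UltraFilter U & \oo `<=` U.
Proof. by have [U [UU Uoo]] := ultraFilterLemma (F := \oo) _; exists U. Qed.

(* Pointwise-stated closure properties, so that the topological space stays
   abstract while they are being proved. *)
Section Continuity.
Context {R : realType} {S : topologicalType}.

Lemma continuous_comp_fun (T1 T2 : topologicalType) (f : S -> T1) (g : T1 -> T2) :
  continuous f -> continuous g -> continuous (fun x => g (f x)).
Proof. by move=> cf cg x; apply: (cvg_comp _ g (cf x)); exact: cg. Qed.

Lemma continuous_add (p q : nat) (f g : S -> 'M[R]_(p, q)) :
  continuous f -> continuous g -> continuous (fun x => f x + g x).
Proof. by move=> cf cg x; apply: cvgD; [exact: cf | exact: cg]. Qed.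

Lemma continuous_sub (p q : nat) (f g : S -> 'M[R]_(p, q)) :
  continuous f -> continuous g -> continuous (fun x => f x - g x).
Proof. by move=> cf cg x; apply: cvgB; [exact: cf | exact: cg]. Qed.

Lemma continuous_scale (p q : nat) (k : S -> R) (f : S -> 'M[R]_(p, q)) :
  continuous k -> continuous f -> continuous (fun x => k x *: f x).
Proof. by move=> ck cf x; apply: cvgZ; [exact: ck | exact: cf]. Qed.

Lemma continuous_mul (f g : S -> R) :
  continuous f -> continuous g -> continuous (fun x => f x * g x).
Proof. by move=> cf cg x; apply: cvgM; [exact: cf | exact: cg]. Qed.

Lemma continuous_addr (f g : S -> R) :
  continuous f -> continuous g -> continuous (fun x => f x + g x).
Proof. by move=> cf cg x; apply: cvgD; [exact: cf | exact: cg]. Qed.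

Lemma continuous_const (T : topologicalType) (c : T) :
  continuous (fun _ : S => c).
Proof. exact: cst_continuous. Qed.

Lemma continuous_identity : continuous (fun x : S => x).
Proof. by move=> x; exact: cvg_id. Qed.

End Continuity.

Lemma lipschitz_continuous {R : realType} (V W : normedModType R) (f : V -> W)
    (k : R) : 0 < k -> (forall x y, `|f x - f y| <= k * `|x - y|) -> continuous f.
Proof.
move=> k0 fk x; apply/cvgrPdist_le => e e0.
have : \forall y \near x, `|x - y| <= e / k.
  by apply: cvgr_dist_le; [exact: cvg_id | rewrite divr_gt0].
by apply: filterS => y; rewrite ler_pdivlMr // mulrC; exact: le_trans (fk x y).
Qed.

Lemma continuous_pairing {S T1 T2 : topologicalType} (f : S -> T1) (g : S -> T2) :
  continuous f -> continuous g -> continuous (fun x => (f x, g x)).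
Proof.
by move=> cf cg x; apply: (@cvg_pair _ _ _ _ (nbhs (f x)) (nbhs (g x)));
   [exact: cf | exact: cg].
Qed.

Lemma nbhs_dist_lt {R : realType} {W : normedModType R} (p : W) (e : R) :
  0 < e -> nbhs p [set b | `|p - b| < e].
Proof. by move=> e0; apply/nbhs_normP; exists e. Qed.

Lemma nbhs_dist_ex {R : realType} {W : normedModType R} (p : W) (B : set W) :
  nbhs p B -> exists2 e : R, 0 < e & forall b, `|p - b| < e -> B b.
Proof. by move=> /nbhs_normP[e /= e0 eB]; exists e. Qed.

(** * Brouwer's fixed point theorem *)

Section Brouwer.
Context {R : realType} {p q : nat}.
Notation mat := 'M[R]_(p, q).
Local Notation ix := ('I_p * 'I_q)%type.

(** Scale the lattice points of a simplex so that, up to a shift by [L], they fill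
    a simplex containing the range of [f]; the index [None] is the slack
    coordinate.  A point gets the colour of a coordinate that [f] does not
    decrease, and [None] if there is none.  The points of a rainbow cell have a
    common limit [x].  For a coordinate in the colour set [x <= f x] holds by
    continuity; for the others [x] sits on the facet where this is trivial.  The
    slack coordinate provides the opposite inequality for the sums. *)
Theorem brouwer_bounded (f : mat -> mat) (L : R) :
  continuous f -> (forall X i j, `|f X i j| <= L) -> exists X, f X = X.
Proof.
move=> cf fL0; wlog L0 : L fL0 / 0 < L.
  move=> /(_ (`|L| + 1)); apply; last by rewrite ltr_wpDl.
  by move=> X i j; rewrite (le_trans (fL0 X i j)) // (le_trans (ler_norm L)) // lerDl.
pose S : R := L * 2 * #|{: ix}|%:R + 1.
have S0 : 0 < S by rewrite ltr_wpDl // !mulr_ge0 // ltW.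
pose M : R := #|{: option ix}|%:R.
pose h (k : nat) : R := k.+1%:R^-1.
have h0 k : 0 < h k by rewrite invr_gt0.
pose pt (k : nat) (a : option ix -> nat) : mat :=
  \matrix_(i, j) (S * ((a (Some (i, j)))%:R * h k) - L).
pose colour k a : option ix :=
  if [pick ij : ix | pt k a ij.1 ij.2 <= f (pt k a) ij.1 ij.2] is Some ij
  then Some ij else None.
have colS k a i j : colour k a = Some (i, j) -> pt k a i j <= f (pt k a) i j.
  by rewrite /colour; case: pickP => // -[i' j'] /= H [<- <-].
have colN k a i j : colour k a = None -> f (pt k a) i j <= pt k a i j.
  by rewrite /colour; case: pickP => // H _; rewrite ltW // ltNge (H (i, j)).
have grid k := Scarf.rainbow_grid_points None k.+1 (colour k).
have [C gridC] := choice grid; have [b Cb] := choice gridC.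
have C_ex k : exists i, i \in C k by apply/set0Pn; case: (Cb k).
have [i0 i0C] := choice C_ex.
pose a k := b k (i0 k).
have bsum k i : i \in C k -> (\sum_l b k i l)%N = k.+1.
  by case: (Cb k) => _ H _ _ /H[].
have bcol k i : i \in C k -> colour k (b k i) = i.
  by case: (Cb k) => _ H _ _ /H[].
have bclose k i l : i \in C k -> `|(b k i l)%:R - (a k l)%:R| <= M :> R.
  move=> iC; case: (Cb k) => _ _ H _; rewrite ler_distl.
  by rewrite lerBlDr -!natrD !ler_nat !H.
have bfar k l : l \notin C k -> (a k l)%:R <= M :> R.
  by move=> lC; case: (Cb k) => _ _ _ H; rewrite ler_nat H.
have [U UU Uoo] := ultra_oo; have PU := @ultra_proper _ _ UU.
have hU : h k @[k --> U] --> 0.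
  by move=> A /(cvg_harmonic (R := R)); exact: Uoo.
have ale k l : ((a k l)%:R * h k) <= 1 :> R.
  by rewrite ler_pdivrMr // mul1r ler_nat -(bsum k (i0 k)) // (bigD1 l) //= leq_addr.
have [x ax] : exists x : mat, pt k (a k) @[k --> U] --> x.
  apply: (@ultra_cvg_bounded_mx _ _ U UU _ _ _ (S + L)); apply: nearW => k.
  apply: norm_le_entries => [|i j]; first by rewrite addr_ge0 // ltW.
  rewrite mxE (le_trans (ler_normB _ _)) // lerD //; last by rewrite gtr0_norm.
  by rewrite ger0_norm ?mulr_ge0 ?(ltW S0) ?(ltW (h0 _)) // ler_piMr // ltW.
have MhU : S * (M * h k) @[k --> U] --> S * (M * 0).
  by apply: cvgMr; apply: cvgMr.
have near0 (u : nat -> R) : (forall k, `|u k| <= S * (M * h k)) -> u k @[k --> U] --> 0.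
  move=> uM; apply: norm_cvg0; apply: squeeze_cvgr (cvg_cst 0) _; last first.
    by move: MhU; rewrite !mulr0; apply.
  by apply: nearW => k; rewrite normr_ge0 uM.
have bx i : U [set k | i \in C k] ->
   exists2 y : nat -> mat, y k @[k --> U] --> x &
     \forall k \near U, exists2 c, colour k c = i & y k = pt k c.
  move=> Ui; pose c k := if i \in C k then b k i else a k.
  exists (fun k => pt k (c k)); last first.
    by apply: filterS Ui => k /= iC; exists (b k i); rewrite /c ?iC ?bcol.
  rewrite -[x]addr0 -[X in X @ _](subrK (fun k => pt k (a k))) /= addrC.
  apply: cvgD => //; apply: cvg_entries => l j; rewrite mxE; apply: near0 => k.
  rewrite !mxE opprB addrA subrK -mulrBr -mulrBl !normrM.
  rewrite (gtr0_norm S0) (gtr0_norm (h0 k)) ler_pM2l // ler_pM2r // /c.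
  by case: ifP => [/bclose|_] //; rewrite subrr normr0.
have le_x i j : x i j <= f x i j.
  have [Ui|Ui] := in_ultra_setVsetC [set k | Some (i, j) \in C k] UU.
    have [y yx yc] := bx _ Ui.
    apply: (ler_cvg_to (cvg_entry yx) (cvg_entry (cvg_comp _ _ yx (cf x)))).
    by apply: filterS yc => k [c /colS cS ->].
  apply: (@le_trans _ _ (- L)); last first.
    by have := fL0 x i j; rewrite ler_norml => /andP[].
  rewrite -[- L]add0r.
  have : S * (M * h k) - L @[k --> U] --> 0 - L.
    by apply: cvgB; [move: MhU; rewrite !mulr0; apply | exact: cvg_cst].
  move=> hx; apply: (ler_cvg_to (cvg_entry (i := i) (j := j) ax) hx).
  apply: filterS Ui => k /negP /bfar abf; rewrite mxE lerD2r ler_pM2l // ler_pM2r //.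
have sum_cvg (y : nat -> mat) (z : mat) : y k @[k --> U] --> z ->
    \sum_ij y k ij.1 ij.2 @[k --> U] --> \sum_ij z ij.1 ij.2.
  move=> yz; apply: cvg_big => [|ij _]; first exact: add_continuous.
  exact: cvg_entry.
have le_sum : \sum_ij f x ij.1 ij.2 <= \sum_ij x ij.1 ij.2.
  have [Ui|Ui] := in_ultra_setVsetC [set k | None \in C k] UU.
    have [y yx yc] := bx _ Ui.
    apply: (ler_cvg_to (sum_cvg _ _ (cvg_comp _ _ yx (cf x))) (sum_cvg _ _ yx)).
    by apply: filterS yc => k [c /colN cS ->]; apply: ler_sum => -[i j] _.
  apply: (@le_trans _ _ (L * #|{: ix}|%:R)).
    rewrite mulr_natr -sumr_const; apply: ler_sum => -[i j] _.
    exact: le_trans (ler_norm _) (fL0 _ _ _).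
  have hx : S - L * #|{: ix}|%:R - S * (M * h k) @[k --> U] -->
      S - L * #|{: ix}|%:R - 0.
    by apply: cvgB; [exact: cvg_cst | move: MhU; rewrite !mulr0; apply].
  have := ler_cvg_to hx (sum_cvg _ _ ax); rewrite subr0 => lim_le.
  apply: (@le_trans _ _ (S - L * #|{: ix}|%:R)); first by rewrite /S; lra.
  apply: lim_le.
  apply: filterS Ui => k /negP /bfar abf.
  rewrite (eq_bigr (fun ij => S * h k * (a k (Some ij))%:R - L)); last first.
    by move=> [i j] _; rewrite mxE -mulrA [h k * _]mulrC.
  rewrite sumrB sumr_const -[L *+ _]mulr_natr -mulr_sumr -natr_sum.
  have -> : (\sum_ij a k (Some ij))%:R = k.+1%:R - (a k None)%:R :> R.
    rewrite -(bsum k (i0 k)) //= (bigD1 None) //= natrD addrC addKr.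
    congr _%:R; rewrite [RHS](reindex_omap Some id) /=; last by case.
    by apply: eq_bigl => i; rewrite eqxx.
  have hk : S * h k * k.+1%:R = S by rewrite -mulrA mulVf ?mulr1.
  have : S * h k * (a k None)%:R <= S * (M * h k).
    by rewrite -mulrA [M * _]mulrC !ler_pM2l.
  by rewrite mulrBr hk; lra.
exists x; apply/matrixP => i j; apply/eqP; rewrite eq_le le_x andbT leNgt.
apply/negP => lt_ij; move: le_sum; apply/negP; rewrite -ltNge.
rewrite (bigD1 (i, j)) // [ltRHS](bigD1 (i, j)) //=.
by apply: ltr_leD => //; apply: ler_sum => -[i' j'] _; exact: le_x.
Qed.
End Brouwer.

(** * Euclidean geometry and variational inequalities *)

Section DotProduct.
Context {R : realType} {n : nat}.
Implicit Types u v w : 'rV[R]_n.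

Lemma dotvC u v : dotv u v = dotv v u.
Proof. by apply: eq_bigr => i _; rewrite mulrC. Qed.

Lemma dotvDl u v w : dotv (u + v) w = dotv u w + dotv v w.
Proof. by rewrite /dotv -big_split /=; apply: eq_bigr => i _; rewrite mxE mulrDl. Qed.

Lemma dotvZl a u v : dotv (a *: u) v = a * dotv u v.
Proof. by rewrite /dotv mulr_sumr; apply: eq_bigr => i _; rewrite mxE mulrA. Qed.

Lemma dotvDr u v w : dotv u (v + w) = dotv u v + dotv u w.
Proof. by rewrite dotvC dotvDl !(dotvC u). Qed.

Lemma dotvZr a u v : dotv u (a *: v) = a * dotv u v.
Proof. by rewrite dotvC dotvZl dotvC. Qed.

Lemma dotvNl u v : dotv (- u) v = - dotv u v.
Proof. by rewrite -scaleN1r dotvZl mulN1r. Qed.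

Lemma dotvNr u v : dotv u (- v) = - dotv u v.
Proof. by rewrite dotvC dotvNl dotvC. Qed.

Lemma dotvBl u v w : dotv (u - v) w = dotv u w - dotv v w.
Proof. by rewrite dotvDl dotvNl. Qed.

Lemma dotvBr u v w : dotv u (v - w) = dotv u v - dotv u w.
Proof. by rewrite dotvDr dotvNr. Qed.

Lemma dotv0l u : dotv 0 u = 0.
Proof. by rewrite -(scale0r 0) dotvZl mul0r. Qed.

Lemma dotv0r u : dotv u 0 = 0. Proof. by rewrite dotvC dotv0l. Qed.

Definition dotvE := (dotvDl, dotvDr, dotvNl, dotvNr, dotvZl, dotvZr).

Lemma dotvv_ge0 u : 0 <= dotv u u.
Proof. by apply: sumr_ge0 => i _; rewrite -expr2 sqr_ge0. Qed.

Lemma dotvv_eq0 u : (dotv u u == 0) = (u == 0).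
Proof.
apply/eqP/eqP => [u0|->]; last exact: dotv0l.
apply/rowP => i; rewrite mxE; apply/eqP; rewrite -sqrf_eq0 expr2.
by apply/eqP/(psumr_eq0P _ u0) => // j _; rewrite -expr2 sqr_ge0.
Qed.

Lemma dotvv_gt0 u : u != 0 -> 0 < dotv u u.
Proof. by move=> u0; rewrite lt0r dotvv_eq0 u0 dotvv_ge0. Qed.

Lemma cauchy_schwarz u v : dotv u v ^+ 2 <= dotv u u * dotv v v.
Proof.
have [->|v0] := eqVneq v 0; first by rewrite !dotv0r expr0n mulr0.
have := dotvv_ge0 (dotv v v *: u - dotv u v *: v).
rewrite !dotvE (dotvC v u) => H.
have vv := dotvv_gt0 v0; rewrite -subr_ge0 -(pmulr_rge0 _ vv); apply: le_trans H _.
by rewrite le_eqVlt; apply/orP; left; apply/eqP; ring.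
Qed.

Lemma dotvv_subZ t u v :
  dotv (u - t *: v) (u - t *: v) = dotv u u - 2 * t * dotv u v + t ^+ 2 * dotv v v.
Proof. by rewrite !dotvE (dotvC v u); ring. Qed.

Definition enorm u : R := Num.sqrt (dotv u u).

Lemma enorm_ge0 u : 0 <= enorm u. Proof. exact: sqrtr_ge0. Qed.

Lemma sqr_enorm u : enorm u ^+ 2 = dotv u u.
Proof. by rewrite sqr_sqrtr // dotvv_ge0. Qed.

Lemma normr_dotv u v : `|dotv u v| <= enorm u * enorm v.
Proof.
rewrite -(@ler_pXn2r _ 2) ?nnegrE ?mulr_ge0 ?enorm_ge0 //.
by rewrite exprMn !sqr_enorm real_normK ?num_real ?cauchy_schwarz.
Qed.

Lemma dotv_le u v : dotv u v <= enorm u * enorm v.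
Proof. exact: le_trans (ler_norm _) (normr_dotv u v). Qed.

Lemma enormZ a u : enorm (a *: u) = `|a| * enorm u.
Proof.
by rewrite /enorm dotvZl dotvZr mulrA -expr2 sqrtrM ?sqr_ge0 // sqrtr_sqr.
Qed.

Lemma enormN u : enorm (- u) = enorm u.
Proof. by rewrite /enorm dotvNl dotvNr opprK. Qed.

Lemma enormD u v : enorm (u + v) <= enorm u + enorm v.
Proof.
rewrite -(@ler_pXn2r _ 2) ?nnegrE ?addr_ge0 ?enorm_ge0 //.
rewrite sqrrD !sqr_enorm !dotvE (dotvC v u).
by have := dotv_le u v; lra.
Qed.

Lemma norm_le_enorm u : `|u| <= enorm u.
Proof.
apply: norm_le_entries => [|i j]; first exact: enorm_ge0.
rewrite (ord1 i) -sqrtr_sqr ler_wsqrtr // /dotv (bigD1 j) //= expr2 lerDl.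
by apply: sumr_ge0 => k _; rewrite -expr2 sqr_ge0.
Qed.

Lemma normr_dotv_le u v : `|dotv u v| <= n%:R * (`|u| * `|v|).
Proof.
rewrite mulr_natl -[X in _ <= _ *+ X]card_ord -sumr_const.
apply: le_trans (ler_norm_sum _ _ _) _; apply: ler_sum => i _.
by rewrite normrM ler_pM // entry_le_norm.
Qed.

Lemma enorm_le_norm u : enorm u <= n%:R * `|u|.
Proof.
rewrite -(@ler_pXn2r _ 2) ?nnegrE ?mulr_ge0 ?enorm_ge0 //.
rewrite sqr_enorm (le_trans (ler_norm _)) // (le_trans (normr_dotv_le _ _)) //.
rewrite -expr2 exprMn ler_wpM2r ?sqr_ge0 // expr2 -natrM ler_nat.
by case: n => // m; rewrite leq_pmulr.
Qed.

Lemma cvg_dotv (S : Type) (F : set_system S) {FF : Filter F}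
    (f g : S -> 'rV[R]_n) u v :
  f x @[x --> F] --> u -> g x @[x --> F] --> v ->
  dotv (f x) (g x) @[x --> F] --> dotv u v.
Proof.
move=> fu gv; apply: cvg_big => [|i _]; first exact: add_continuous.
by apply: cvgM; exact: cvg_entry.
Qed.

Lemma continuous_dotv (S : topologicalType) (f g : S -> 'rV[R]_n) :
  continuous f -> continuous g -> continuous (fun x => dotv (f x) (g x)).
Proof. by move=> cf cg x; apply: cvg_dotv; [exact: cf | exact: cg]. Qed.

End DotProduct.

Section Projection.
Context {R : realType} {n : nat} (C : set 'rV[R]_n).
Hypotheses (C0 : C !=set0) (cC : compact C).
Hypothesis convC : forall p q (t : R), C p -> C q -> 0 <= t <= 1 -> C (p + t *: (q - p)).

Lemma projection_convex : exists P : 'rV[R]_n -> 'rV[R]_n,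
  [/\ continuous P, forall x, C (P x)
    & forall x q, C q -> dotv (x - P x) (q - P x) <= 0].
Proof.
have ex_proj (x : 'rV[R]_n) : exists p, C p /\ forall q, C q -> dotv (x - p) (q - p) <= 0.
  have cd : continuous (fun y : 'rV[R]_n => dotv (x - y) (x - y)).
    have cx : continuous (fun y : 'rV[R]_n => x - y).
      apply: continuous_sub; first exact: continuous_const.
      exact: continuous_identity.
    exact: continuous_dotv.
  have [p] := compact_EVT_min C0 cC (continuous_subspaceT cd).
  rewrite inE => Cp pmin; exists p; split=> // q Cq; rewrite leNgt; apply/negP => pos.
  set a := dotv (x - p) (q - p) in pos; set b := dotv (q - p) (q - p).
  (* moving from p towards q by t changes the squared distance by t^2 b - 2 t a *)
  have b0 : 0 <= b := dotvv_ge0 _.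
  pose t := a / (a + b).
  have ab : 0 < a + b by rewrite ltr_wpDr.
  have t0 : 0 < t by rewrite divr_gt0.
  have t1 : t <= 1 by rewrite ler_pdivrMr // mul1r lerDl.
  have Cz : C (p + t *: (q - p)) by apply: convC => //; rewrite t1 ltW.
  have := pmin _ (mem_set Cz).
  have -> : x - (p + t *: (q - p)) = (x - p) - t *: (q - p) by rewrite opprD addrA.
  rewrite dotvv_subZ -/a -/b => H; have : t * (2 * a) <= t * (t * b) by lra.
  rewrite ler_pM2l // /t mulrAC ler_pdivlMr //; nra.
have [P HP] := choice ex_proj; exists P; split; last 2 first.
- by move=> x; case: (HP x).
- by move=> x; case: (HP x).
have lip x y : enorm (P x - P y) <= enorm (x - y).
  have HPx := HP x; have HPy := HP y.
  have [->|ne] := eqVneq (P x - P y) 0.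
    by rewrite {1}/enorm dotv0l sqrtr0 enorm_ge0.
  have pos : 0 < enorm (P x - P y) by rewrite sqrtr_gt0 dotvv_gt0.
  rewrite -(ler_pM2r pos) -expr2 sqr_enorm; apply: le_trans (dotv_le _ _).
  have := HPx.2 _ HPy.1; have := HPy.2 _ HPx.1.
  by rewrite -[P y - P x]opprB dotvNr !dotvBl; lra.
apply: (lipschitz_continuous (k := n%:R + 1)) => [|x y]; first by rewrite ltr_wpDl.
apply: le_trans (norm_le_enorm _) _; apply: le_trans (lip _ _) _.
by apply: le_trans (enorm_le_norm _) _; rewrite ler_wpM2r // lerDl.
Qed.

(** A fixed point of [X |-> P (P X - F (P X))], where [P] projects every row
    onto [C]. *)
Theorem variational_inequality {m : nat} (F : 'M[R]_(m, n) -> 'M[R]_(m, n)) :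
  continuous F ->
  exists X : 'M[R]_(m, n),
    (forall i : 'I_m, C (row i X)) /\
    (forall (i : 'I_m) q, C q -> 0 <= dotv (row i (F X)) (q - row i X)).
Proof.
move=> cF; have [P [cP PC PV]] := projection_convex.
have [B PB] : exists B, forall x, `|P x| <= B.
  have [M [_ HM]] := compact_bounded cC.
  by exists (M + 1) => x; apply: HM; rewrite ?ltrDl.
pose PP (X : 'M[R]_(m, n)) : 'M[R]_(m, n) := \matrix_i P (row i X).
have crow i : continuous (fun X : 'M[R]_(m, n) => row i X).
  apply: continuous_entries => j k; under eq_fun do rewrite mxE.
  exact: coord_continuous.
have cPP : continuous PP.
  apply: continuous_entries => i j; under eq_fun do rewrite mxE.
  apply: (@continuous_comp_fun _ _ _ (fun X => P (row i X)) (fun v : 'rV_n => v 0 j)).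
    exact: (@continuous_comp_fun _ _ _ (row i) P).
  exact: coord_continuous.
have cG : continuous (fun X => PP (PP X - F (PP X))).
  apply: (@continuous_comp_fun _ _ _ (fun X => PP X - F (PP X)) PP) => //.
  by apply: continuous_sub => //; exact: (@continuous_comp_fun _ _ _ PP F).
have [|X XE] := @brouwer_bounded _ _ _ _ B cG.
  by move=> X i j; rewrite mxE; exact: le_trans (entry_le_norm _ _ _) (PB _).
have Pid x : C x -> P x = x.
  move=> /(PV x) H; apply/eqP.
  by rewrite eq_sym -subr_eq0 -dotvv_eq0 eq_le dotvv_ge0 H.
have rowPP Z i : row i (PP Z) = P (row i Z) by apply/rowP => j; rewrite !mxE.
have CX i : C (row i X) by rewrite -XE rowPP.
have PPX : PP X = X by apply/row_matrixP => i; rewrite rowPP Pid.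
rewrite PPX in XE; exists X; split=> // i q Cq.
have := PV (row i (X - F X)) q Cq; rewrite -rowPP XE linearB /=.
by rewrite addrAC subrr add0r dotvNl oppr_le0.
Qed.
End Projection.

(** * Derivatives along curves *)

Section Calculus.
Context {R : realType} {n : nat}.

Lemma diff_grad (f : 'rV[R]_n -> R) u y : differentiable f u ->
  'd f u y = dotv (grad f u) y.
Proof.
move=> df; rewrite [in LHS](row_sum_delta y) linear_sum; apply: eq_bigr => i _.
by rewrite linearZ /= -deriveE // mxE mulrC.
Qed.

Lemma is_derive_curve (W : normedModType R) (F : 'rV[R]_n -> W)
    (c : R -> 'rV[R]_n) (t : R) (dc : 'rV[R]_n) :
  differentiable F (c t) -> is_derive t 1 c dc ->
  is_derive t 1 (fun s => F (c s)) ('d F (c t) dc).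
Proof.
move=> dF [dct dcE]; have dc1 : differentiable c t by apply/derivable1_diffP.
have dFc : differentiable (F \o c) t by apply: differentiable_comp.
apply: DeriveDef; first exact/derivable1_diffP.
rewrite deriveE // diff_comp //=; congr ('d F (c t) _).
by rewrite -dcE deriveE.
Qed.

Lemma is_derive_along (f : 'rV[R]_n -> R) (c : R -> 'rV[R]_n) (t : R) (dc : 'rV[R]_n) :
  differentiable f (c t) -> is_derive t 1 c dc ->
  is_derive t 1 (fun s => f (c s)) (dotv (grad f (c t)) dc).
Proof. by move=> df ?; rewrite -diff_grad //; exact: is_derive_curve. Qed.

Lemma is_derive_coord (c : R -> 'rV[R]_n) (t : R) (dc : 'rV[R]_n) i :
  is_derive t 1 c dc -> is_derive t 1 (fun s => c s 0 i) (dc 0 i).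
Proof.
move=> [dct <-]; apply: DeriveDef; first by move/derivable_mxP: dct; apply.
by rewrite derive_mx // mxE.
Qed.

Lemma is_derive_dotv (f g : R -> 'rV[R]_n) (t : R) (df dg : 'rV[R]_n) :
  is_derive t 1 f df -> is_derive t 1 g dg ->
  is_derive t 1 (fun s => dotv (f s) (g s)) (dotv df (g t) + dotv (f t) dg).
Proof.
move=> Df Dg.
have -> : (fun s => dotv (f s) (g s)) =
    \sum_(i < n) ((fun s => f s 0 i) * (fun s => g s 0 i)).
  by apply/funext => s; rewrite fct_sumE.
apply: is_derive_eq.
  apply: is_derive_sum => i; apply: is_deriveM; exact: is_derive_coord.
rewrite -big_split /=; apply: eq_bigr => i _ /=.
by rewrite addrC; congr (_ + _); rewrite mulrC.
Qed.

Lemma is_derive_line (W : normedModType R) (a b : W) (t : R) :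
  is_derive t 1 (fun s : R => a + s *: b) b.
Proof.
have -> : (fun s : R => a + s *: b) = cst a + (fun s : R => s *: b) by [].
have := @is_diff_scalel R W t b => -[ds dsE].
have -> : b = 0 + b by rewrite add0r.
rewrite {1}add0r; apply: is_deriveD; apply: DeriveDef.
  exact/derivable1_diffP.
by rewrite deriveE // dsE /= scale1r.
Qed.

Lemma is_derive_scalev (W : normedModType R) (k : R -> R) (w : W) (t dk : R) :
  is_derive t 1 k dk -> is_derive t 1 (fun s => k s *: w) (dk *: w).
Proof.
move=> [dkt <-]; have dk1 : differentiable k t by apply/derivable1_diffP.
have dkw : differentiable (fun s => k s *: w) t by apply: differentiableZl.
apply: DeriveDef; first exact/derivable1_diffP.
by rewrite deriveE // diffZl //= -deriveE.
Qed.
End Calculus.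

Section RealFunctions.
Context {R : realType}.
Implicit Types f g : R -> R.

Lemma derive_pos_right f (t l : R) : is_derive t 1 f l -> 0 < l ->
  exists2 e, 0 < e & forall s, t < s < t + e -> f t < f s.
Proof.
move=> [df <-] l0.
have : h^-1 *: (f (h + t) - f t) @[h --> 0^'] --> 'D_1 f t.
  have <- : (fun h : R => h^-1 *: ((f \o shift t) (h *: (1 : R)) - f t)) =
      (fun h => h^-1 *: (f (h + t) - f t)).
    by apply/funext => h /=; rewrite [h *: _]mulr1.
  exact: df.
move=> /cvgrPdist_lt/(_ _ l0).
rewrite /dnbhs => /= /nbhs_ballP[e /= e0 H]; exists e => // s /andP[ts se].
have : ball (0 : R) e (s - t).
  by rewrite /ball /= sub0r normrN gtr0_norm ?subr_gt0 // ltrBlDl.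
move=> /H; rewrite subr_eq0 gt_eqF // subrK => /(_ isT).
rewrite ltr_distlC => /andP[]; rewrite subrr => + _.
by rewrite /GRing.scale /= pmulr_rgt0 ?invr_gt0 ?subr_gt0.
Qed.

Lemma interior_max_derive2 f g (a b t l : R) : a < t < b ->
  (forall s, a < s < b -> is_derive s 1 f (g s)) ->
  (forall s, a < s < b -> f s <= f t) -> is_derive t 1 g l -> g t = 0 /\ l <= 0.
Proof.
move=> /andP[at_ tb] fg fmax gl.
have abt : t \in `]a, b[ by rewrite in_itv /= at_ tb.
have g0 : g t = 0.
  have ab : a <= b by rewrite ltW // (lt_trans at_).
  have [_ <-] : is_derive t 1 f (g t) by apply: fg; rewrite at_ tb.
  have [s|s|_ ->//] := @derive1_at_max R f a b t ab _ abt _.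
    by rewrite in_itv /= => /fg[].
  by rewrite in_itv /= => /fmax.
split=> //; rewrite leNgt; apply/negP => l0.
have [e e0 ge] := derive_pos_right gl l0.
pose s := Num.min (t + e / 2) ((t + b) / 2).
have st : t < s by rewrite lt_min ltrDl divr_gt0 //=; lra.
have sb : s < b by rewrite gt_min; apply/orP; right; lra.
have se : s < t + e by rewrite gt_min ltrD2l; apply/orP; left; lra.
have dfs r : t < r < s -> is_derive r 1 f (g r).
  by move=> /andP[tr rs]; apply: fg; rewrite (lt_trans at_) // (lt_trans rs).
have cf : {within `[t, s], continuous f}.
  apply: continuous_in_subspaceT => r; rewrite inE /= in_itv /= => /andP[tr rs].
  have [df _] : is_derive r 1 f (g r).
    by apply: fg; rewrite (lt_le_trans at_) // (le_lt_trans rs).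
  by apply: differentiable_continuous; apply/derivable1_diffP.
have dfI r : r \in `]t, s[ -> is_derive r 1 f (g r).
  by rewrite in_itv /=; exact: dfs.
have [r] := MVT st dfI cf.
rewrite in_itv /= => /andP[tr rs] E.
have := fmax s; rewrite (lt_trans at_ st) sb => /(_ isT).
apply/negP; rewrite -ltNge -subr_gt0 E mulr_gt0 ?subr_gt0 // -g0.
by apply: ge; rewrite tr (lt_trans rs).
Qed.

Lemma is_derive_quadratic (a b c t : R) :
  is_derive t 1 (fun s : R => a * s ^+ 2 + b * s + c) (2 * a * t + b).
Proof.
have -> : (fun s : R => a * s ^+ 2 + b * s + c) =
    cst a * (id ^+ 2) + cst b * id + cst c.
  by apply/funext => s.
by apply: is_derive_eq; rewrite /GRing.scale /= /cst; ring.
Qed.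
End RealFunctions.

(** * Convexity from the curvature of a level set *)

(** The contact set is compact, so its first coordinate has a minimum. *)
Lemma first_contact {R : realType} {S : topologicalType} (A : set S) (a b : R)
    (f : R * S -> R) :
  compact A -> continuous f ->
  (exists s x, [/\ a <= s <= b, A x & 0 <= f (s, x)]) ->
  exists s x, [/\ a <= s <= b, A x, 0 <= f (s, x),
    forall r y, a <= r < s -> A y -> f (r, y) < 0
    & a < s -> forall y, A y -> f (s, y) <= 0].
Proof.
move=> cA cf [s0 [x0 [s0ab Ax0 f0]]].
pose K : set (R * S) := (`[a, b]%classic `*` A) `&` (f @^-1` [set r | 0 <= r]).
have cK : compact K.
  apply: compact_closedI.
    by apply: compact_setX => //; exact: segment_compact.
  by apply: preimage_closed; [move=> ? _; exact: cf | exact: closed_ge].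
have K0 : K !=set0 by exists (s0, x0); split=> //; split=> //=; rewrite in_itv.
have cfst : continuous (fst : R * S -> R) by move=> p; exact: cvg_fst.
have [[s x]] := compact_EVT_min K0 cK (continuous_subspaceT cfst).
rewrite inE => -[[/=]]; rewrite in_itv /= => sab Ax fsx smin.
have before r y : a <= r < s -> A y -> f (r, y) < 0.
  move=> /andP[ar rs] Ay; rewrite ltNge; apply/negP => fr.
  have : (r, y) \in K.
    rewrite inE; split=> //; split=> //=; rewrite in_itv /= ar /=.
    by rewrite (le_trans (ltW rs)) //; case/andP: sab.
  by move=> /smin /=; rewrite leNgt rs.
exists s, x; split=> // lt_as y Ay; rewrite leNgt; apply/negP => fpos.
have : continuous (fun r => f (r, y)).
  apply: (@continuous_comp_fun _ _ _ (fun r : R => (r, y)) f) => //.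
  by apply: continuous_pairing; [exact: continuous_identity | exact: continuous_const].
move=> /(_ s).
move=> /cvgrPdist_lt/(_ _ fpos)/nbhs_ballP[e /= e0 near_s].
pose r := Num.max a (s - e / 2).
have rs : r < s by rewrite gt_max lt_as /=; lra.
have ser : s - e < r by rewrite lt_max; apply/orP; right; lra.
have : ball s e r by rewrite /ball /= gtr0_norm; lra.
move=> /near_s; rewrite ltr_distlC => /andP[]; rewrite subrr => fr _.
have := before r y; rewrite rs le_max lexx => /(_ isT Ay).
by rewrite ltNge ltW.
Qed.

Section SublevelSet.
Context {R : realType} {n : nat} (V : 'rV[R]_n -> R).
Hypothesis V2 : class_C2 V.
Hypothesis V_regular : forall u, V u = 0 -> grad V u != 0.
Hypothesis V_curved : forall u y, V u = 0 -> dotv (grad V u) y = 0 ->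
  0 <= dotv (y *m hessian V u) y.
Implicit Types a b c p q u v y : 'rV[R]_n.

Lemma diff_V u : differentiable V u. Proof. by case: V2 => -[]. Qed.

Lemma diff_gradV u : differentiable (grad V) u. Proof. by case: V2. Qed.

Lemma cont_V : continuous V.
Proof. by move=> u; apply: differentiable_continuous; exact: diff_V. Qed.

Lemma cont_gradV : continuous (grad V). Proof. by case: V2 => -[]. Qed.

Lemma grad_pos_near u v : 0 < dotv (grad V u) v ->
  exists2 r, 0 < r & forall w, `|w - u| < r -> 0 < dotv (grad V w) v.
Proof.
move=> pos; have : continuous (fun w => dotv (grad V w) v).
  by apply: continuous_dotv; [exact: cont_gradV | exact: continuous_const].
move=> /(_ u) /cvgrPdist_lt/(_ _ pos)/nbhs_normP[r /= r0 H]; exists r => // w wu.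
have := H w; rewrite /= distrC => /(_ wu).
by rewrite ltr_distlC => /andP[]; rewrite subrr.
Qed.

Lemma V_mean_value u v : exists2 t, 0 < t < 1 &
  V (u + v) - V u = dotv (grad V (u + t *: v)) v.
Proof.
have dV (t : R) : is_derive t 1 (fun s => V (u + s *: v)) (dotv (grad V (u + t *: v)) v).
  by apply: is_derive_along; [exact: diff_V | exact: is_derive_line].
have cV : {within `[0, 1], continuous (fun s : R => V (u + s *: v))}.
  apply: continuous_in_subspaceT => t _; have [dt _] := dV t.
  by apply: differentiable_continuous; apply/derivable1_diffP.
have [t] := MVT ltr01 (fun t _ => dV t) cV; rewrite in_itv /= => tI.
by rewrite scale1r scale0r addr0 subr0 mulr1 => ->; exists t.
Qed.

Lemma V_increases u v : dotv (grad V u) v > 0 -> V u = 0 ->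
  forall e, 0 < e -> exists2 s, 0 < s < e & V (u + s *: v) > 0 /\ V (u - s *: v) < 0.
Proof.
move=> pos Vu e e0; have [r r0 near_u] := grad_pos_near pos.
pose s := Num.min (e / 2) (r / 2 / (`|v| + 1)).
have v1 : 0 < `|v| + 1 by rewrite ltr_wpDl.
have s0 : 0 < s by rewrite lt_min !divr_gt0.
have se : s < e by rewrite gt_min; apply/orP; left; lra.
have sv : s * `|v| < r.
  apply: (@le_lt_trans _ _ (r / 2)); last by lra.
  apply: (@le_trans _ _ (s * (`|v| + 1))); first by rewrite ler_pM2l // lerDl.
  by rewrite -ler_pdivlMr // ge_min lexx orbT.
have near t : `|t| < 1 -> 0 < dotv (grad V (u + t *: (s *: v))) v.
  move=> t1; apply: near_u; rewrite addrAC subrr add0r !normrZ (gtr0_norm s0).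
  by apply: le_lt_trans sv; rewrite ler_piMl ?mulr_ge0 // ltW.
exists s; rewrite ?s0 //; split.
  have [t /andP[t0 t1]] := V_mean_value u (s *: v).
  rewrite Vu subr0 dotvZr => ->; rewrite mulr_gt0 // near //.
  by rewrite gtr0_norm.
have [t /andP[t0 t1]] := V_mean_value u (- (s *: v)).
rewrite Vu subr0 dotvNr dotvZr scalerN -scaleNr => ->.
by rewrite oppr_lt0 mulr_gt0 // near // normrN gtr0_norm.
Qed.

(** A line cannot enter the set [V < 0] from a point of [V = 0] while staying
    in [V <= 0] on the other side.  Bend it into the parabolas below, which are
    strictly convex towards the outer normal; push them outwards until the
    first contact with [V >= 0].  There the curvature of the level set and that
    of the parabola add up to a positive second derivative at a maximum. *)
Lemma no_tangential_entry u y (t0 : R) : 0 < t0 -> V u = 0 ->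
  (forall t : R, `|t| <= t0 -> V (u + t *: y) <= 0) ->
  (forall t : R, 0 < t <= t0 -> V (u + t *: y) < 0) -> False.
Proof.
move=> t0_gt0 Vu Vle Vlt; set nu := grad V u.
have nu0 : 0 < dotv nu nu by rewrite dotvv_gt0 // V_regular.
have [r r0 near_u] := grad_pos_near nu0.
have [t1 [t1_gt0 t1t0 t1y]] : exists t1, [/\ 0 < t1, t1 <= t0 & t1 * `|y| < r / 2].
  have y1 : 0 < `|y| + 1 by rewrite ltr_wpDl.
  exists (Num.min t0 (r / 4 / (`|y| + 1))); split.
  - by rewrite lt_min t0_gt0 !divr_gt0.
  - by rewrite ge_min lexx.
  apply: (@le_lt_trans _ _ (r / 4)); last by lra.
  apply: (@le_trans _ _ (Num.min t0 (r / 4 / (`|y| + 1)) * (`|y| + 1))).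
    by rewrite ler_wpM2l // ?lerDl // le_min ltW // ltW // !divr_gt0.
  by rewrite -ler_pdivlMr // ge_min lexx orbT.
have [s1 [s1_gt0 s1nu Vs1]] : exists s1,
    [/\ 0 < s1, 2 * s1 * `|nu| < r / 2 & V (u + t1 *: y + s1 *: nu) < 0].
  have Vt1 : 0 < - V (u + t1 *: y) by rewrite oppr_gt0 Vlt // t1_gt0.
  have : continuous (fun s : R => V (u + t1 *: y + s *: nu)).
    apply: (@continuous_comp_fun _ _ _ (fun s : R => u + t1 *: y + s *: nu) V).
      apply: continuous_add; first exact: continuous_const.
      by apply: continuous_scale; [exact: continuous_identity | exact: continuous_const].
    exact: cont_V.
  move=> /(_ 0) /cvgrPdist_lt/(_ _ Vt1)/nbhs_normP[e /= e0 H].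
  have nu1 : 0 < `|nu| + 1 by rewrite ltr_wpDl.
  pose s1 := Num.min (e / 2) (r / 8 / (`|nu| + 1)).
  have s1_gt0 : 0 < s1 by rewrite lt_min !divr_gt0.
  exists s1; split=> //.
    apply: (@le_lt_trans _ _ (2 * (s1 * (`|nu| + 1)))).
      by rewrite -mulrA ler_pM2l // ler_pM2l // lerDl.
    have : s1 * (`|nu| + 1) <= r / 8 by rewrite -ler_pdivlMr // ge_min lexx orbT.
    by lra.
  have := H s1; rewrite /= sub0r normrN gtr0_norm // scale0r addr0.
  rewrite ltr_distlC opprK -/s1 => /(_ _)/andP[].
    by rewrite gt_min; apply/orP; left; lra.
  by move=> _; rewrite addrC subrr.
(* these values make [sg 0] negative at [- t1] and [3 / 4 * s1 < s1] at [t1],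
   which excludes a contact at the ends *)
pose m := s1 / (2 * t1); pose eps := s1 / (4 * t1 ^+ 2).
have eps0 : 0 < eps by rewrite divr_gt0 // mulr_gt0 // exprn_gt0.
pose sg (c t : R) := eps * t ^+ 2 + m * t + c.
have m_t1 : m * t1 = s1 / 2 by rewrite /m; field; lra.
have e_t1 : eps * t1 ^+ 2 = s1 / 4 by rewrite /eps; field; lra.
have m0 : 0 < m by rewrite divr_gt0 // mulr_gt0.
have sg_le t : `|t| <= t1 -> - (3 / 4 * s1) <= sg 0 t <= 3 / 4 * s1.
  move=> tt1; have : eps * t ^+ 2 <= s1 / 4.
    by rewrite -e_t1 ler_pM2l // -[t ^+ 2]real_normK ?num_real // ler_pXn2r ?nnegrE // ltW.
  have : `|m * t| <= s1 / 2 by rewrite normrM gtr0_norm // -m_t1 ler_pM2l.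
  have : 0 <= eps * t ^+ 2 by rewrite mulr_ge0 ?sqr_ge0 // ltW.
  by rewrite ler_norml /sg => ? /andP[? ?] ?; apply/andP; split; lra.
have near_seg t s : `|t| <= t1 -> `|s| <= 2 * s1 ->
    0 < dotv (grad V (u + t *: y + s *: nu)) nu.
  move=> tt1 ss1; apply: near_u; rewrite -(addrA u (t *: y)) addrAC subrr add0r.
  apply: le_lt_trans (ler_normD _ _) _; rewrite !normrZ (splitr r).
  apply: ltrD.
    by apply: le_lt_trans t1y; rewrite ler_wpM2r.
  by apply: le_lt_trans s1nu; rewrite ler_wpM2r.
have mono t s s' : `|t| <= t1 -> `|s| <= 2 * s1 -> `|s'| <= 2 * s1 -> s < s' ->
    V (u + t *: y + s *: nu) < V (u + t *: y + s' *: nu).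
  move=> tt1 hs hs' ss'; have [k /andP[k0 k1]] :=
    V_mean_value (u + t *: y + s *: nu) ((s' - s) *: nu).
  have e1 l : u + t *: y + s *: nu + l *: ((s' - s) *: nu) =
      u + t *: y + (s + l * (s' - s)) *: nu by rewrite scalerA scalerDl addrA.
  rewrite -{1}[(s' - s) *: nu]scale1r !e1 mul1r [s + (s' - s)]addrC subrK => E.
  rewrite -subr_gt0 E dotvZr mulr_gt0 ?subr_gt0 // near_seg //.
  move: hs hs'; rewrite !ler_norml => /andP[? ?] /andP[? ?]; apply/andP; split; nra.
pose Phi (p : R * R) := V (u + p.2 *: y + sg p.1 p.2 *: nu).
have cPhi : continuous Phi.
  have cp2 : continuous (fun p : R * R => p.2) by move=> p; exact: cvg_snd.
  have cp1 : continuous (fun p : R * R => p.1) by move=> p; exact: cvg_fst.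
  apply: (@continuous_comp_fun _ _ _ (fun p : R * R => u + p.2 *: y + sg p.1 p.2 *: nu) V).
    apply: continuous_add.
      apply: continuous_add; first exact: continuous_const.
      by apply: continuous_scale => //; exact: continuous_const.
    apply: continuous_scale; last exact: continuous_const.
    move=> p; apply: cvgD; last exact: cp1.
    apply: cvgD.
      apply: cvgMr; apply: (cvg_comp _ (fun x : R => x ^+ 2) (cp2 p)).
      exact: exprn_continuous.
    by apply: cvgMr; exact: cp2.
  exact: cont_V.
have sgD (k t : R) : sg k t = sg 0 t + k by rewrite /sg addr0.
have V0E t : u + t *: y = u + t *: y + 0 *: nu by rewrite scale0r addr0.
have [k [t [/andP[c_ge c_le]]]] : exists k t : R, [/\ - s1 <= k <= 0,
    (`[- t1, t1]%classic : set R) t, 0 <= Phi (k, t),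
    forall r t', - s1 <= r < k -> (`[- t1, t1]%classic : set R) t' -> Phi (r, t') < 0
    & - s1 < k -> forall t', (`[- t1, t1]%classic : set R) t' -> Phi (k, t') <= 0].
  have [|k [t [cI tI Pct Plt Ple]]] :=
    first_contact (a := - s1) (b := 0) (@segment_compact _ (- t1) t1) cPhi.
    exists 0, 0; split; [lra | by rewrite /= in_itv /=; lra |].
    by rewrite /Phi /sg /= expr0n /= !mulr0 !addr0 !scale0r !addr0 Vu.
  by exists k, t; split.
rewrite /= in_itv /= -ler_norml => tI Pct Plt Ple.
have bounds t' : `|t'| <= t1 -> `|sg k t'| <= 2 * s1.
  by move=> /sg_le /andP[? ?]; rewrite ler_norml sgD; apply/andP; split; lra.
have b0 : `|0 : R| <= 2 * s1 by rewrite normr0; lra.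
have s1c : - s1 < k.
  rewrite lt_neqAle c_ge andbT; apply/eqP => s1c; move: Pct; rewrite leNgt => /negP[].
  have /andP[_ ?] := sg_le t tI.
  apply: (@lt_le_trans _ _ (V (u + t *: y))); last by rewrite Vle // (le_trans tI).
  by rewrite [X in _ < V X]V0E /Phi /= mono ?bounds // sgD -s1c; lra.
have Pc_le t' : `|t'| <= t1 -> Phi (k, t') <= 0.
  by move=> t't1; apply: (Ple s1c) => /=; rewrite in_itv /= -ler_norml.
have Pct0 : Phi (k, t) = 0 by apply/le_anti; rewrite Pct Pc_le.
have t1_norm : `|t1| <= t1 by rewrite gtr0_norm.
have t_t1 : t != t1.
  apply/eqP => tt1; move: Pct; rewrite leNgt => /negP[]; rewrite tt1.
  apply: (le_lt_trans _ Vs1); have := bounds t1 t1_norm.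
  have sgt1 : sg k t1 = 3 / 4 * s1 + k by rewrite /sg e_t1 m_t1; lra.
  move=> hb; apply/ltW/mono => //; first by rewrite gtr0_norm //; lra.
  by rewrite sgt1; lra.
have t_Nt1 : t != - t1.
  apply/eqP => tt1; move: Pct; rewrite leNgt => /negP[]; rewrite tt1.
  have Nt1 : `|- t1| <= t1 by rewrite normrN.
  apply: (@lt_le_trans _ _ (V (u + (- t1) *: y))); last by rewrite Vle // normrN gtr0_norm.
  rewrite [X in _ < V X]V0E /Phi /= mono ?bounds //.
  by rewrite /sg sqrrN e_t1 mulrN m_t1; lra.
have tI' : - t1 < t < t1.
  by move: tI; rewrite ler_norml !le_eqVlt [- t1 == t]eq_sym (negPf t_t1) (negPf t_Nt1).
pose gam (s : R) : 'rV[R]_n := u + s *: y + sg k s *: nu.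
pose dgam (s : R) : 'rV[R]_n := y + m *: nu + s *: ((2 * eps) *: nu).
have dgamP (s : R) : is_derive s 1 gam (dgam s).
  have dsg : is_derive s 1 (sg k) (2 * eps * s + m) by exact: is_derive_quadratic.
  have -> : dgam s = y + (2 * eps * s + m) *: nu.
    by rewrite /dgam scalerA [s * _]mulrC scalerDl -!addrA [m *: nu + _]addrC.
  apply: is_deriveD; first exact: is_derive_line.
  exact: is_derive_scalev.
have d2gam : is_derive t 1 dgam ((2 * eps) *: nu) by exact: is_derive_line.
have dPhi s : - t1 < s < t1 -> is_derive s 1 (fun r => V (gam r))
    (dotv (grad V (gam s)) (dgam s)).
  by move=> _; apply: is_derive_along; exact: diff_V.
have d2Phi := is_derive_dotv (is_derive_curve (diff_gradV (gam t)) (dgamP t)) d2gam.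
have Phi_max s : - t1 < s < t1 -> V (gam s) <= V (gam t).
  move=> sI; rewrite [leRHS]Pct0; apply: Pc_le.
  by rewrite ler_norml; case/andP: sI => *; apply/andP; split; lra.
have [crit] := interior_max_derive2 tI' dPhi Phi_max d2Phi.

apply/negP; rewrite -ltNge ltr_wpDl //; last first.
  have e2 : 0 < 2 * eps by lra.
  by rewrite dotvZr (mulr_gt0 e2) //; apply: near_seg; rewrite ?bounds.
by rewrite -[X in dotv X _]mul_rV_lin1; exact: V_curved.
Qed.
End SublevelSet.

Section Visible.
Context {R : realType} {n : nat} (V : 'rV[R]_n -> R).
Hypothesis V2 : class_C2 V.
Hypothesis V_regular : forall u, V u = 0 -> grad V u != 0.
Hypothesis V_curved : forall u y, V u = 0 -> dotv (grad V u) y = 0 ->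
  0 <= dotv (y *m hessian V u) y.
Variable a : 'rV[R]_n.
Hypothesis Va : V a < 0.
Implicit Types b c p q u v y : 'rV[R]_n.

Definition visible : set 'rV[R]_n :=
  [set b | forall s : R, 0 <= s <= 1 -> V (a + s *: (b - a)) < 0].

Lemma visible_V b : visible b -> V b < 0.
Proof. by move=> /(_ 1); rewrite scale1r addrC subrK; apply; rewrite ler01 lexx. Qed.

Lemma visible_base : visible a.
Proof. by move=> s _; rewrite subrr scaler0 addr0. Qed.

Lemma continuous_ray (T : topologicalType) (k : T -> R) (f : T -> 'rV[R]_n) :
  continuous k -> continuous f -> continuous (fun x => V (a + k x *: (f x - a))).
Proof.
move=> ck cf; apply: (@continuous_comp_fun _ _ _ (fun x => a + k x *: (f x - a)) V).
  apply: continuous_add; first exact: continuous_const.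
  by apply: continuous_scale => //; apply: continuous_sub => //; exact: continuous_const.
exact: cont_V.
Qed.

(** Sweep the triangle [a, b, c] by segments parallel to [b, c]: the first one to
    touch [V >= 0] would contradict [no_tangential_entry]. *)
Lemma visible_convex b c (t : R) : visible b -> visible c -> 0 <= t <= 1 ->
  visible (b + t *: (c - b)).
Proof.
move=> vb vc t01 s s01; rewrite ltNge; apply/negP => V_ge0.
pose Q (p : R * R) := V (a + p.1 *: ((b + p.2 *: (c - b)) - a)).
have cbc : continuous (fun t : R => b + t *: (c - b)).
  apply: continuous_add; first exact: continuous_const.
  by apply: continuous_scale; [exact: continuous_identity | exact: continuous_const].
have cQ : continuous Q.
  apply: continuous_ray; first by move=> p; exact: cvg_fst.
  apply: (@continuous_comp_fun _ _ _ (fun p : R * R => p.2) (fun t : R => b + t *: (c - b))) => //.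
  by move=> p; exact: cvg_snd.
have [|s1 [t1 [/andP[s1_ge0 s1_le1] t1I Qs1 _ Qle]]] :=
    first_contact (a := 0) (b := 1) (@segment_compact _ 0 1) cQ.
  by exists s, t; split.
have s1_gt0 : 0 < s1.
  rewrite lt_neqAle s1_ge0 andbT; apply/eqP => s1E; move: Qs1.
  by rewrite /Q /= -s1E scale0r addr0 leNgt Va.
have cQ1 : continuous (fun p : R * R => Q (s1, p.1)).
  apply: (@continuous_comp_fun _ _ _ (fun p : R * R => (s1, p.1)) Q) => //.
  by apply: continuous_pairing; [exact: continuous_const | move=> p; exact: cvg_fst].
have in00 : (`[0, 0]%classic : set R) 0 by rewrite /= in_itv /= lexx.
have [|t2 [z [/andP[t2_ge0 t2_le1] _ Qt2 Qlt _]]] :=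
    first_contact (a := 0) (b := 1) (@segment_compact _ 0 0) cQ1.
  by exists t1, 0; split=> //; move: t1I; rewrite /= in_itv.
have t2_gt0 : 0 < t2.
  rewrite lt_neqAle t2_ge0 andbT; apply/eqP => t2E; move: Qt2.
  by rewrite /Q /= -t2E scale0r addr0 leNgt vb // s1_ge0.
have t2_lt1 : t2 < 1.
  rewrite lt_neqAle t2_le1 andbT; apply/eqP => t2E; move: Qt2.
  by rewrite /Q /= t2E scale1r [b + _]addrC subrK leNgt vc // s1_ge0.
pose u := a + s1 *: ((b + t2 *: (c - b)) - a).
have QE (r : R) : V (u + r *: (- s1 *: (c - b))) = Q (s1, t2 - r).
  congr V; apply/rowP => i; rewrite /u !mxE /=; ring.
apply: (@no_tangential_entry _ _ V V2 V_regular V_curved u (- s1 *: (c - b))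
    (Num.min t2 (1 - t2))).
- by rewrite lt_min t2_gt0 subr_gt0.
- apply/le_anti/andP; split=> //; apply: (Qle s1_gt0) => /=.
  by rewrite in_itv /= t2_ge0.
- move=> r; rewrite le_min !ler_norml => /andP[/andP[? ?] /andP[? ?]].
  by rewrite QE; apply: (Qle s1_gt0); rewrite /= in_itv /=; apply/andP; split; lra.
move=> r /andP[r0]; rewrite le_min => /andP[rt _].
by rewrite QE; apply: (Qlt _ 0) => //; rewrite subr_ge0 rt ltrBlDr ltrDl r0.
Qed.

Lemma visible_open b : visible b ->
  exists2 r, 0 < r & forall c, `|c - b| <= r -> visible c.
Proof.
move=> vb; have [[c0 [c0b [s0 s0I Vc0]]]|none] :=
    pselect (exists c, `|c - b| <= 1 /\ exists2 s : R, 0 <= s <= 1 & 0 <= V (a + s *: (c - a))).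
  pose K : set (R * 'rV[R]_n) := (`[0, 1]%classic `*` [set c | `|c - b| <= 1]) `&`
     [set p | 0 <= V (a + p.1 *: (p.2 - a))].
  have cdist : continuous (fun c => `|c - b|).
    apply: (@continuous_comp_fun _ _ _ (fun c => c - b) (fun w : 'rV[R]_n => `|w|)).
      apply: continuous_sub; first exact: continuous_identity.
      exact: continuous_const.
    exact: norm_continuous.
  have cK : compact K.
    apply: compact_closedI.
      apply: compact_setX; first exact: segment_compact.
      apply: bounded_closed_compact.
        exists (`|b| + 1); split; first exact: num_real.
        move=> M ltM c /= cb1; apply: le_trans (ltW ltM); rewrite -[c](subrK b) addrC.
        by apply: le_trans (ler_normD _ _) _; rewrite lerD2l.
      apply: (@preimage_closed _ _ (fun c => `|c - b|) [set r | r <= 1]).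
        by move=> ? _; exact: cdist.
      exact: closed_le.
    apply: (@preimage_closed _ _ (fun p : R * 'rV[R]_n => V (a + p.1 *: (p.2 - a)))
              [set r | 0 <= r]); last exact: closed_ge.
    move=> p _; move: p; apply: continuous_ray => p; [exact: cvg_fst | exact: cvg_snd].
  have K0 : K !=set0 by exists (s0, c0); split=> //; split=> //=; rewrite in_itv.
  have cd : continuous (fun p : R * 'rV[R]_n => `|p.2 - b|).
    apply: (@continuous_comp_fun _ _ _ (fun p : R * 'rV[R]_n => p.2) (fun c => `|c - b|)) => //.
    by move=> p; exact: cvg_snd.
  have [[s1 c1]] := compact_EVT_min K0 cK (continuous_subspaceT cd).
  rewrite inE => -[[/=]]; rewrite in_itv /= => s1I c1b Vc1 cmin.
  have c1b0 : 0 < `|c1 - b|.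
    rewrite normr_gt0 subr_eq0; apply/eqP => c1E; move: Vc1.
    by rewrite c1E leNgt vb.
  exists (`|c1 - b| / 2); first by rewrite divr_gt0.
  move=> c cb s sI; rewrite ltNge; apply/negP => Vc.
  have : (s, c) \in K.
    rewrite inE; split=> //; split; first by rewrite /= in_itv.
    by apply: le_trans cb _; lra.
  move=> /cmin /=; apply/negP; rewrite -ltNge; lra.
exists 1 => // c cb s sI; rewrite ltNge; apply/negP => Vc; apply: none.
by exists c; split=> //; exists s.
Qed.

Let C : set 'rV[R]_n := closure visible.

Lemma visible_closure b : visible b -> C b. Proof. exact: subset_closure. Qed.

Lemma closure_visible_near p (e : R) : C p -> 0 < e ->
  exists2 b, visible b & `|p - b| < e.
Proof.
move=> Cp e0; have [|b [vb pb]] := Cp [set b | `|p - b| < e].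
  exact: nbhs_dist_lt.
by exists b.
Qed.

Lemma closure_visible_le0 p : C p -> V p <= 0.
Proof.
have cl : closed [set p | V p <= 0].
  apply: (@preimage_closed _ _ V [set r | r <= 0]); last exact: closed_le.
  by move=> ? _; exact: cont_V.
move=> Cp; have : closure [set p | V p <= 0] p.
  by move: Cp; apply: closure_subset => b /visible_V /ltW.
by rewrite -(closure_id _).1.
Qed.

Lemma closure_visible_convex p q (t : R) : C p -> C q -> 0 <= t <= 1 ->
  C (p + t *: (q - p)).
Proof.
move=> Cp Cq t01 B /nbhs_dist_ex[e e0 eB].
have e2 : 0 < e / 2 by rewrite divr_gt0.
have [b vb pb] := closure_visible_near Cp e2.
have [c vc qc] := closure_visible_near Cq e2.
exists (b + t *: (c - b)); split; first exact: visible_convex.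
apply: eB; move: t01 => /andP[t0 t1].
have -> : p + t *: (q - p) - (b + t *: (c - b)) = (1 - t) *: (p - b) + t *: (q - c).
  by apply/rowP => i; rewrite !mxE; ring.
apply: le_lt_trans (ler_normD _ _) _; rewrite !normrZ.
rewrite ger0_norm ?subr_ge0 // (ger0_norm t0).
have : (1 - t) * `|p - b| <= (1 - t) * (e / 2) by rewrite ler_wpM2l ?subr_ge0 // ltW.
have : t * `|q - c| <= t * (e / 2) by rewrite ler_wpM2l // ltW.
by move=> *; nra.
Qed.

(** The point lies on a segment from a visible point near [a] to a visible point
    near [p]. *)
Lemma closure_visible_star p (t : R) : C p -> 0 <= t < 1 ->
  visible (a + t *: (p - a)).
Proof.
move=> Cp /andP[t0 t1]; have [r r0 ball_a] := visible_open visible_base.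
have u0 : 0 < 1 - t by rewrite subr_gt0.
have [b vb pb] := closure_visible_near Cp (mulr_gt0 r0 u0).
have va' : visible (a + (t / (1 - t)) *: (p - b)).
  apply: ball_a; rewrite addrAC subrr add0r normrZ ger0_norm ?divr_ge0 ?(ltW u0) //.
  rewrite mulrAC ler_pdivrMr //; apply: le_trans (ltW pb).
  by rewrite ler_piMl // ltW.
have t01 : 0 <= t <= 1 by rewrite t0 ltW.
have := visible_convex va' vb t01; congr visible.
by apply/rowP => i; rewrite !mxE; field; lra.
Qed.

Lemma closure_visible_interior p : C p -> V p < 0 -> visible p.
Proof.
move=> Cp Vp s /andP[s0]; rewrite le_eqVlt => /predU1P[->|s1].
  by rewrite scale1r addrC subrK.
by apply: visible_V; apply: closure_visible_star; rewrite ?s0.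
Qed.

Lemma closure_visible_support p q : C p -> V p = 0 -> C q ->
  dotv (grad V p) (q - p) <= 0.
Proof.
move=> Cp Vp Cq; rewrite leNgt; apply/negP => pos.
have [s /andP[s0 s1] [Vs _]] := V_increases V2 pos Vp ltr01.
move: Vs; rewrite ltNge => /negP; apply; apply: closure_visible_le0.
by apply: closure_visible_convex => //; rewrite !ltW.
Qed.

(** Near [p], [V] decreases along every combination of [a - p] and [v] with
    nonnegative coefficients; away from [p], the segment from [a] to [p] has a
    visible neighbourhood. *)
Lemma closure_visible_inward p v : C p -> V p = 0 -> dotv (grad V p) v < 0 ->
  exists2 s : R, 0 < s & C (p + s *: v).
Proof.
move=> Cp Vp gv; set nu := grad V p.
have nu0 : 0 < dotv nu nu by rewrite dotvv_gt0 // V_regular.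
have ga : 0 < dotv nu (p - a).
  have [r r0 ball_a] := visible_open visible_base.
  have nu1 : 0 < `|nu| + 1 by rewrite ltr_wpDl.
  have : C (a + (r / (`|nu| + 1)) *: nu).
    apply/visible_closure/ball_a; rewrite addrAC subrr add0r normrZ.
    rewrite gtr0_norm ?divr_gt0 // mulrAC ler_pdivrMr // ler_pM2l // lerDl //.
  move=> /(closure_visible_support Cp Vp); rewrite !dotvE -/nu.
  have : 0 < r / (`|nu| + 1) * dotv nu nu by rewrite mulr_gt0 // divr_gt0.
  by lra.
have gv' : 0 < dotv nu (- v) by rewrite dotvNr oppr_gt0.
have [r1 r1_gt0 near_a] := grad_pos_near V2 ga.
have [r2 r2_gt0 near_v] := grad_pos_near V2 gv'.
pose r := Num.min r1 r2.
have r0 : 0 < r by rewrite lt_min r1_gt0.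
have [t0 [t0_gt0 t0_lt1 t0r]] : exists t0 : R,
    [/\ 0 < t0, t0 < 1 & (1 - t0) * `|a - p| < r / 2].
  have pa1 : 0 < `|a - p| + 1 by rewrite ltr_wpDl.
  pose k := Num.min (1 / 2) (r / 4 / (`|a - p| + 1)).
  have k0 : 0 < k by rewrite lt_min !divr_gt0.
  have k1 : k <= 1 / 2 by rewrite ge_min lexx.
  exists (1 - k); split; [lra | lra |].
  have : k * (`|a - p| + 1) <= r / 4 by rewrite -ler_pdivlMr // ge_min lexx orbT.
  by nra.
have [r' r'0 ball_p0] : exists2 r', 0 < r' & forall c,
    `|c - (a + t0 *: (p - a))| <= r' -> visible c.
  by apply/visible_open/closure_visible_star => //; rewrite ltW.
have v1 : 0 < `|v| + 1 by rewrite ltr_wpDl.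
pose s := Num.min (r / 4) r' / (`|v| + 1).
have s0 : 0 < s by rewrite divr_gt0 // lt_min r'0 divr_gt0.
have sv : s * `|v| <= Num.min (r / 4) r'.
  rewrite /s mulrAC ler_pdivrMr // ler_pM2l ?lerDl // lt_min r'0 divr_gt0 //.
have [svr svr'] : s * `|v| <= r / 4 /\ s * `|v| <= r'.
  by apply/andP; rewrite -le_min.
exists s => //; apply: visible_closure => k /andP[k0 k1].
have [kt0|t0k] := leP k t0.
  have -> : a + k *: (p + s *: v - a) =
      a + (k / t0) *: ((a + t0 *: (p - a)) + (t0 * s) *: v - a).
    by apply/rowP => i; rewrite !mxE; field; lra.
  have : visible ((a + t0 *: (p - a)) + (t0 * s) *: v).
    apply: ball_p0; rewrite addrAC subrr add0r normrZ normrM !gtr0_norm //.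
    apply: le_trans svr'; rewrite -mulrA; apply: ler_piMl; last exact: ltW.
    by apply: mulr_ge0 => //; exact: ltW.
  by apply; rewrite divr_ge0 ?(ltW t0_gt0) //= ler_pdivrMr // mul1r.
pose z := (1 - k) *: (a - p) + (k * s) *: v.
have -> : a + k *: (p + s *: v - a) = p + z.
  by apply/rowP => i; rewrite /z !mxE; ring.
have zr : `|z| < r.
  have k1N : `|1 - k| = 1 - k by rewrite ger0_norm // subr_ge0.
  have ksN : `|k * s| = k * s by rewrite normrM (gtr0_norm s0) (ger0_norm k0).
  apply: le_lt_trans (ler_normD _ _) _; rewrite (normrZ (1 - k)) (normrZ (k * s)) k1N ksN.
  have : (1 - k) * `|a - p| <= (1 - t0) * `|a - p|.
    by rewrite ler_wpM2r // lerD2l lerN2 ltW.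
  have : k * s * `|v| <= r / 4.
    apply: le_trans svr; rewrite -mulrA; apply: ler_piMl => //.
    by apply: mulr_ge0 => //; exact: ltW.
  by lra.
have [th /andP[th0 th1]] := V_mean_value V2 p z.
have thz : `|p + th *: z - p| < r.
  rewrite addrAC subrr add0r normrZ gtr0_norm //; apply: le_lt_trans zr.
  by rewrite ler_piMl // ltW.
rewrite Vp subr0 => ->; rewrite dotvDr !dotvZr.
have /near_a : `|p + th *: z - p| < r1 by rewrite (lt_le_trans thz) // ge_min lexx.
have /near_v : `|p + th *: z - p| < r2 by rewrite (lt_le_trans thz) // ge_min lexx orbT.
rewrite -(opprB a p) !dotvNr !oppr_gt0 => gv0 ga0.
have : (1 - k) * dotv (grad V (p + th *: z)) (a - p) <= 0.
  by rewrite mulr_ge0_le0 ?subr_ge0 // ltW.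
have : k * s * dotv (grad V (p + th *: z)) v < 0.
  by rewrite pmulr_rlt0 // mulr_gt0 // (lt_trans t0_gt0).
by lra.
Qed.

(** On the boundary, test with the inward direction [- v - grad V p]. *)
Lemma closure_visible_normal p v : C p ->
  (forall q, C q -> 0 <= dotv v (q - p)) ->
  (V p = 0 -> 0 <= dotv (grad V p) v) -> v = 0.
Proof.
move=> Cp vi out; apply/eqP; rewrite -dotvv_eq0 eq_le dotvv_ge0 andbT.
have [Vp|Vp] : V p < 0 \/ V p = 0.
  by have := closure_visible_le0 Cp; rewrite le_eqVlt => /predU1P[]; [right | left].
  have [r r0 ball_p] := visible_open (closure_visible_interior Cp Vp).
  have v1 : 0 < `|v| + 1 by rewrite ltr_wpDl.
  have k0 : 0 < r / (`|v| + 1) by rewrite divr_gt0.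
  have : C (p - (r / (`|v| + 1)) *: v).
    apply/visible_closure/ball_p; rewrite addrAC subrr add0r normrN normrZ.
    by rewrite gtr0_norm // mulrAC ler_pdivrMr // ler_pM2l // lerDl.
  move=> /vi; rewrite addrAC subrr add0r dotvNr dotvZr oppr_ge0.
  by rewrite pmulr_rle0.
have nu0 : 0 < dotv (grad V p) (grad V p) by rewrite dotvv_gt0 // V_regular.
have := out Vp; have [|s s0] := closure_visible_inward (v := - v - grad V p) Cp Vp.
  by have := out Vp; rewrite !dotvE; lra.
move=> /vi; rewrite addrAC subrr add0r dotvZr pmulr_rge0 // !dotvE.
by rewrite (dotvC v (grad V p)); lra.
Qed.

End Visible.

(** [C] is the closure of the set of points of [V < 0] that can be seen from one
    of them; this isolates a convex piece without any connectedness argument. *)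
Theorem convex_component {R : realType} {n : nat} (V : 'rV[R]_n -> R) :
  class_C2 V -> (forall u, V u = 0 -> grad V u != 0) ->
  (forall u y, V u = 0 -> dotv (grad V u) y = 0 ->
    0 <= dotv (y *m hessian V u) y) ->
  [set u | V u <= 0] !=set0 -> bounded_set [set u | V u <= 0] ->
  exists C : set 'rV[R]_n,
  [/\ C !=set0 /\ compact C,
      forall p q (t : R), C p -> C q -> 0 <= t <= 1 -> C (p + t *: (q - p)),
      forall p, C p -> V p <= 0,
      forall p q, C p -> V p = 0 -> C q -> dotv (grad V p) (q - p) <= 0
    & forall p v, C p -> (forall q, C q -> 0 <= dotv v (q - p)) ->
        (V p = 0 -> 0 <= dotv (grad V p) v) -> v = 0].
Proof.
move=> V2 Vr Vc [u /= Vu] bD.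
have [a Va] : exists a, V a < 0.
  move: Vu; rewrite le_eqVlt => /predU1P[Vu|]; last by exists u.
  have nu0 : 0 < dotv (grad V u) (grad V u) by rewrite dotvv_gt0 // Vr.
  by have [s _ [_ ?]] := V_increases V2 nu0 Vu ltr01; exists (u - s *: grad V u).
exists (closure (visible V a)); split.
- split; first by exists a; apply/subset_closure/visible_base.
  apply: bounded_closed_compact; last exact: closed_closure.
  move: bD; apply: filterS => M HM p Cp; apply: HM.
  exact: closure_visible_le0 Cp.
- by move=> p q t; exact: closure_visible_convex.
- by move=> p; exact: closure_visible_le0.
- by move=> p q; exact: closure_visible_support.
by move=> p v; exact: closure_visible_normal.
Qed.

(** * The periodic difference equation *)

Section DiscreteProblem.
Context {R : realType} {n : nat}.
Variables (phi psi gam : 'rV[R]_n -> 'rV[R]_n) (h : R -> 'rV[R]_n -> 'rV[R]_n).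
Variables (C : set 'rV[R]_n) (nu : 'rV[R]_n -> 'rV[R]_n) (B : set 'rV[R]_n).
Variables (T : R) (N : nat).
Let dl : R := T / N.+1%:R.
Hypothesis T0 : 0 < T.
Hypotheses (cphi : continuous phi) (phiK : cancel phi psi).
Hypothesis phi_par : forall x, exists2 k : R, 0 < k & phi x = k *: x.
Hypothesis cgam : continuous gam.
Hypothesis gam_par : forall w, exists2 k : R, k <= dl^-1 & gam w = k *: w.
Hypothesis ch : forall t, 0 <= t <= T -> continuous (h t).
Hypotheses (C0 : C !=set0) (cC : compact C).
Hypothesis C_convex : forall p q (t : R), C p -> C q -> 0 <= t <= 1 ->
  C (p + t *: (q - p)).
Hypothesis C_support : forall p q, C p -> B p -> C q -> dotv (nu p) (q - p) <= 0.
Hypothesis C_normal : forall p v, C p -> (forall q, C q -> 0 <= dotv v (q - p)) ->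
  (B p -> 0 <= dotv (nu p) v) -> v = 0.
Hypothesis h_out : forall t p, 0 <= t <= T -> C p -> B p -> 0 <= dotv (nu p) (h t p).

Let dl0 : 0 < dl. Proof. by rewrite divr_gt0. Qed.

(** The row indices are the nodes of a periodic grid.  Row 0 stands for the right
    endpoint, so that the times of all equations run from [dl] to [T]. *)
Lemma discrete_equation :
  exists X : 'M[R]_(N.+1, n), (forall i, C (row i X)) /\
  forall i : 'I_N.+1,
    let w i := phi (dl^-1 *: (row (ordS i) X - row i X)) in
    w i - w (ord_pred i) = dl *: (gam (w i) +
      h (if i == ord0 then T else i%:R * dl) (row i X)).
Proof.
pose w (X : 'M[R]_(N.+1, n)) (i : 'I_N.+1) := phi (dl^-1 *: (row (ordS i) X - row i X)).
pose tm (i : 'I_N.+1) : R := if i == ord0 then T else i%:R * dl.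
have tmI i : 0 <= tm i <= T.
  rewrite /tm; case: ifP => _; first by rewrite lexx ltW.
  rewrite mulr_ge0 ?(ltW dl0) //= /dl mulrCA ler_piMr ?(ltW T0) //.
  by rewrite ler_pdivrMr // mul1r ler_nat ltnW.
pose f X i := dl *: (gam (w X i) + h (tm i) (row i X)) - (w X i - w X (ord_pred i)).
pose F X : 'M[R]_(N.+1, n) := \matrix_i f X i.
have crow i : continuous (fun X : 'M[R]_(N.+1, n) => row i X).
  apply: continuous_entries => j k; under eq_fun do rewrite mxE.
  exact: coord_continuous.
have cw i : continuous (fun X => w X i).
  apply: (@continuous_comp_fun _ _ _
    (fun X => dl^-1 *: (row (ordS i) X - row i X)) phi) => //.
  apply: continuous_scale; first exact: continuous_const.
  by apply: continuous_sub; exact: crow.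
have cf i : continuous (fun X => f X i).
  apply: continuous_sub; last by apply: continuous_sub; exact: cw.
  apply: continuous_scale; first exact: continuous_const.
  apply: continuous_add; first exact: (@continuous_comp_fun _ _ _ (fun X => w X i) gam).
  by apply: (@continuous_comp_fun _ _ _ (fun X => row i X) (h (tm i))) => //; exact: ch.
have cF : continuous F.
  apply: continuous_entries => i j; under eq_fun do rewrite mxE.
  apply: (@continuous_comp_fun _ _ _ (fun X => f X i) (fun v : 'rV_n => v 0 j)) => //.
  exact: coord_continuous.
have [X [CX VI]] := variational_inequality C0 cC C_convex cF.
exists X; split=> // i /=; rewrite -/(w X i) -/(w X (ord_pred i)) -/(tm i).
have rowF j : row j (F X) = f X j by apply/rowP => k; rewrite !mxE.
apply/eqP; rewrite eq_sym -subr_eq0 -/(f X i) -rowF; apply/eqP.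
apply: (C_normal (CX i) (VI i)) => Bi; rewrite rowF /f.
(* the neighbours of a contact point pull inwards *)
have wi : dotv (nu (row i X)) (w X i) <= 0.
  have [k k0 wE] := phi_par (dl^-1 *: (row (ordS i) X - row i X)).
  rewrite /w wE !dotvZr pmulr_rle0 // pmulr_rle0 ?invr_gt0 //; exact: C_support.
have wp : 0 <= dotv (nu (row i X)) (w X (ord_pred i)).
  have [k k0 wE] := phi_par
    (dl^-1 *: (row (ordS (ord_pred i)) X - row (ord_pred i) X)).
  rewrite /w wE !dotvZr pmulr_rge0 // pmulr_rge0 ?invr_gt0 // ord_predK.
  by rewrite -opprB dotvNr oppr_ge0; exact: C_support.
have ho := h_out (tmI i) (CX i) Bi.
have [k kd ->] := gam_par (w X i).
rewrite dotvBr dotvZr dotvDr dotvZr dotvBr mulrDr mulrA.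
have : 0 <= dl * dotv (nu (row i X)) (h (tm i) (row i X)) by rewrite mulr_ge0 // ltW.
have : 0 <= (dl * k - 1) * dotv (nu (row i X)) (w X i).
  apply: mulr_le0 => //; rewrite subr_le0 mulrC -ler_pdivlMr // mul1r //.
by rewrite mulrBl mul1r; lra.
Qed.

Lemma discrete_solution : exists xs ws : nat -> 'rV[R]_n,
  [/\ forall j, C (xs j),
      xs N.+1 = xs 0 /\ ws N.+1 = ws 0,
      forall j, xs j.+1 - xs j = dl *: psi (ws j)
    & forall j, (j < N.+1)%N -> ws j.+1 - ws j =
        dl *: (gam (ws j.+1) + h (j.+1%:R * dl) (xs j.+1))].
Proof.
have [X [CX EX]] := discrete_equation.
have inS j : ordS (inZp j : 'I_N.+1) = inZp j.+1.
  by apply: val_inj; rewrite /= -addn1 modnDml addn1.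
have inP j : ord_pred (inZp j.+1 : 'I_N.+1) = inZp j by rewrite -inS ordSK.
have in0 : inZp N.+1 = inZp 0 :> 'I_N.+1 by apply: val_inj; rewrite /= modnn mod0n.
pose xs j := row (inZp j) X; pose ws j := phi (dl^-1 *: (xs j.+1 - xs j)).
have x0 : xs N.+1 = xs 0 by rewrite /xs in0.
have x1 : xs N.+2 = xs 1%N by rewrite /xs -(inS N.+1) -(inS 0) in0.
exists xs, ws; split.
- by move=> j; exact: CX.
- by split=> //; rewrite /ws x0 x1.
- by move=> j; rewrite /ws phiK scalerA divff ?gt_eqF // scale1r.
move=> j jN; have := EX (inZp j.+1) => /=; rewrite inP !inS -!/(xs _) -!/(ws _) => ->.
congr (_ *: (_ + h _ _)); rewrite -val_eqE /=.
move: jN; rewrite ltnS leq_eqVlt => /predU1P[->|jN].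
  by rewrite modnn eqxx /dl mulrC divfK.
by rewrite modn_small.
Qed.
End DiscreteProblem.

(** * Limits of grid functions *)

(** One-sided at the endpoints, and in a form that survives passage to the
    limit from difference quotients. *)
Definition has_velocity {R : realType} {n : nat} (T : R)
    (f df : R -> 'rV[R]_n) : Prop :=
  forall t0 : R, 0 <= t0 <= T -> forall e : R, 0 < e -> exists2 d : R, 0 < d &
  forall t, 0 <= t <= T -> `|t - t0| < d ->
    `|f t - f t0 - (t - t0) *: df t0| <= e * `|t - t0|.

Lemma telescope_norm {R : realType} {n : nat} (u : nat -> 'rV[R]_n) (v : 'rV[R]_n)
    (d c : R) (i k : nat) :
  (forall j, (i <= j < i + k)%N -> `|u j.+1 - u j - d *: v| <= c) ->
  `|u (i + k)%N - u i - (k%:R * d) *: v| <= k%:R * c.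
Proof.
elim: k => [_|k IH H]; first by rewrite addn0 subrr !mul0r scale0r subr0 normr0.
have /IH IHk : forall j, (i <= j < i + k)%N -> `|u j.+1 - u j - d *: v| <= c.
  by move=> j /andP[ij jk]; apply: H; rewrite ij addnS ltnW.
have Hk := H (i + k)%N; rewrite leq_addr addnS ltnSn in Hk.
rewrite addnS -natr1 !mulrDl !mul1r scalerDl.
have -> : u (i + k).+1 - u i - ((k%:R * d) *: v + d *: v) =
    (u (i + k)%N - u i - (k%:R * d) *: v) + (u (i + k).+1 - u (i + k)%N - d *: v).
  by apply/rowP => l; rewrite !mxE; ring.
by apply: le_trans (ler_normD _ _) _; apply: lerD => //; exact: Hk.
Qed.

Section GridLimit.
Context {R : realType} {n : nat} (T : R).
Hypothesis T0 : 0 < T.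
Context (U : set_system nat) {UU : UltraFilter U}.
Hypothesis Uoo : \oo `<=` U.

Definition mesh (N : nat) : R := T / N.+1%:R.

Definition cell_index (N : nat) (t : R) : nat := Num.truncn (t / mesh N).

Lemma mesh_gt0 N : 0 < mesh N. Proof. by rewrite divr_gt0. Qed.

Lemma mesh_small (e : R) : 0 < e -> \forall N \near U, mesh N <= e.
Proof.
move=> e0; apply: Uoo; have : T * harmonic N @[N --> \oo] --> T * 0.
  by apply: cvgMr; exact: cvg_harmonic.
rewrite mulr0 => /cvgr0_norm_le/(_ _ e0); apply: filterS => N.
by rewrite ger0_norm // ltW // mesh_gt0.
Qed.

Lemma cell_indexP N (t : R) : 0 <= t <= T ->
  (cell_index N t <= N.+1)%N /\
  (cell_index N t)%:R * mesh N <= t < (cell_index N t)%:R * mesh N + mesh N.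
Proof.
move=> /andP[t0 tT]; have m0 := mesh_gt0 N.
have tm0 : 0 <= t / mesh N by rewrite divr_ge0 // ltW.
have /andP[lo hi] := truncn_itv tm0; split.
  rewrite -(ler_nat R); apply: le_trans lo _.
  by rewrite ler_pdivrMr // /mesh mulrC divfK.
rewrite -ler_pdivlMr // lo /=.
by move: hi; rewrite ltr_pdivrMr // -natr1 mulrDl mul1r.
Qed.

Variables (u : nat -> nat -> 'rV[R]_n) (B L : R).
Hypothesis u_bounded : forall N j, (j <= N.+1)%N -> `|u N j| <= B.
Hypothesis u_step : forall N j, (j < N.+1)%N -> `|u N j.+1 - u N j| <= L * mesh N.

Lemma step_limit : exists v : R -> 'rV[R]_n,
  forall t : R, 0 <= t <= T -> u N (cell_index N t) @[N --> U] --> v t.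
Proof.
have ex t : exists l : 'rV[R]_n, 0 <= t <= T -> u N (cell_index N t) @[N --> U] --> l.
  have [tI|] := boolP (0 <= t <= T); last by exists 0.
  have [|l lP] := @ultra_cvg_bounded_mx R nat U UU 1 n (fun N => u N (cell_index N t)) B.
    by apply: nearW => N; apply: u_bounded; case: (cell_indexP N tI).
  by exists l.
by have [v vP] := choice ex; exists v.
Qed.

Lemma u_lipschitz N i j : (i <= N.+1)%N -> (j <= N.+1)%N ->
  `|u N i - u N j| <= L * `|i%:R * mesh N - j%:R * mesh N|.
Proof.
wlog ij : i j / (i <= j)%N.
  by move=> H; case/orP: (leq_total i j) => *; [|rewrite distrC [X in _ * X]distrC]; exact: H.
move=> _ jN; have [k jE] : exists k, j = (i + k)%N by exists (j - i)%N; rewrite subnKC.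
have /(telescope_norm (v := 0) (d := 0)) : forall l, (i <= l < i + k)%N ->
    `|u N l.+1 - u N l - 0 *: (0 : 'rV[R]_n)| <= L * mesh N.
  move=> l /andP[_ lk]; rewrite scale0r subr0; apply: u_step.
  by rewrite (leq_trans lk) // -jE.
rewrite -jE scaler0 subr0 distrC => /le_trans; apply.
rewrite -mulrBl normrM (gtr0_norm (mesh_gt0 N)) distrC jE natrD addrAC subrr add0r.
by rewrite normr_nat mulrCA.
Qed.

Variable v : R -> 'rV[R]_n.
Hypothesis v_lim : forall t : R, 0 <= t <= T -> u N (cell_index N t) @[N --> U] --> v t.

(** Equicontinuity: the grid functions are uniformly Lipschitz. *)
Lemma near_step_limit (t e : R) : 0 <= t <= T -> 0 < e -> exists2 d : R, 0 < d &
  \forall N \near U, forall j, (j <= N.+1)%N -> `|j%:R * mesh N - t| <= d ->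
    `|u N j - v t| <= e.
Proof.
move=> tI e0; have L1 : 0 < `|L| + 1 by rewrite ltr_wpDl.
pose d := e / (4 * (`|L| + 1)).
have d0 : 0 < d by rewrite divr_gt0 // mulr_gt0.
have Ld : `|L| * (2 * d) <= e / 2.
  have : (`|L| + 1) * (2 * d) = e / 2 by rewrite /d; field; lra.
  by move=> <-; rewrite ler_wpM2r ?lerDl // mulr_ge0 // ltW.
exists d => //; have e2 : 0 < e / 2 by rewrite divr_gt0.
move: (v_lim tI) => /cvgrPdist_le/(_ _ e2) near_v.
near=> N => j jN jt; have [iN /andP[it ti]] := cell_indexP N tI.
rewrite -(subrK (u N (cell_index N t)) (u N j)) -addrA.
apply: le_trans (ler_normD _ _) _; rewrite (splitr e); apply: lerD; last first.
  by rewrite distrC; near: N.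
apply: le_trans (u_lipschitz jN iN) _; apply: le_trans Ld.
apply: le_trans (ler_wpM2r (normr_ge0 _) (ler_norm L)) _; apply: ler_wpM2l => //.
have md : mesh N <= d by near: N; exact: mesh_small.
move: jt; rewrite !ler_norml => /andP[? ?]; apply/andP; split; lra.
Unshelve. all: by end_near. Qed.

(** Difference quotients over one cell that are close to [l] add up to difference
    quotients over many cells, and the latter pass to the limit. *)
Lemma step_limit_velocity (t0 : R) (l : 'rV[R]_n) : 0 <= t0 <= T ->
  (forall e : R, 0 < e -> exists2 d : R, 0 < d & \forall N \near U,
     forall j, (j < N.+1)%N -> `|j%:R * mesh N - t0| <= d ->
     `|u N j.+1 - u N j - mesh N *: l| <= e * mesh N) ->
  forall e : R, 0 < e -> exists2 d : R, 0 < d & forall t, 0 <= t <= T -> `|t - t0| < d ->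
    `|v t - v t0 - (t - t0) *: l| <= e * `|t - t0|.
Proof.
move=> t0I incr e e0; have [d d0 near_d] := incr e e0.
exists (d / 2); first by rewrite divr_gt0.
move=> t tI tt0; have PU := @ultra_proper _ _ UU.
have mesh0 : mesh N @[N --> U] --> 0.
  apply/cvgrPdist_le => c c0; near=> N; rewrite sub0r normrN ger0_norm ?(ltW (mesh_gt0 _)) //.
  by near: N; exact: mesh_small.
have lhs : `|u N (cell_index N t) - u N (cell_index N t0) - (t - t0) *: l| @[N --> U]
    --> `|v t - v t0 - (t - t0) *: l|.
  by apply: cvg_norm; apply: cvgB; [apply: cvgB; exact: v_lim | exact: cvg_cst].
have rhs : e * (`|t - t0| + mesh N) + mesh N * `|l| @[N --> U] -->
    e * (`|t - t0| + 0) + 0 * `|l|.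
  by apply: cvgD; [apply: cvgMr; apply: cvgD => //; exact: cvg_cst | apply: cvgMl].
have := ler_cvg_to lhs rhs; rewrite addr0 mul0r addr0; apply.
near=> N; have m0 := mesh_gt0 N.
have md : mesh N <= d / 2 by near: N; apply: mesh_small; rewrite divr_gt0.
have [] := (cell_indexP N tI, cell_indexP N t0I).
move: (cell_index N t) (cell_index N t0) => i i0 [iN /andP[it ti]] [i0N /andP[it0 t0i]].
have near_N : forall j, (j < N.+1)%N -> `|j%:R * mesh N - t0| <= d ->
     `|u N j.+1 - u N j - mesh N *: l| <= e * mesh N by near: N.
have main : `|u N i - u N i0 - (i%:R * mesh N - i0%:R * mesh N) *: l| <=
    e * `|i%:R * mesh N - i0%:R * mesh N|.
  have tel a b : (a <= b)%N -> (b <= N.+1)%N ->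
      t0 - d <= a%:R * mesh N -> b%:R * mesh N <= t0 + d ->
      `|u N b - u N a - (b%:R * mesh N - a%:R * mesh N) *: l| <=
        e * (b%:R * mesh N - a%:R * mesh N).
    move=> ab bN lo hi.
    have := @telescope_norm _ _ (u N) l (mesh N) (e * mesh N) a (b - a).
    rewrite subnKC // natrB // [_ * (e * _)]mulrCA !mulrBl; apply => j /andP[aj jb].
    apply: near_N; first exact: leq_trans jb bN.
    have : a%:R * mesh N <= j%:R * mesh N by rewrite ler_pM2r // ler_nat.
    have : j%:R * mesh N <= b%:R * mesh N by rewrite ler_pM2r // ler_nat ltnW.
    by rewrite ler_distl => *; apply/andP; split; lra.
  move: tt0; rewrite ltr_distl => /andP[? ?].
  have [ii0|/ltnW i0i] := leqP i i0.
    have -> : u N i - u N i0 - (i%:R * mesh N - i0%:R * mesh N) *: l =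
        - (u N i0 - u N i - (i0%:R * mesh N - i%:R * mesh N) *: l).
      by apply/rowP => k; rewrite !mxE; ring.
    rewrite normrN (distrC (i%:R * mesh N)) [X in e * X]ger0_norm ?subr_ge0 ?ler_pM2r ?ler_nat //.
    by apply: tel => //; lra.
  rewrite [X in e * X]ger0_norm ?subr_ge0 ?ler_pM2r ?ler_nat //.
  by apply: tel => //; lra.
set s := i%:R * mesh N in it ti main *; set s0 := i0%:R * mesh N in it0 t0i main *.
have ss0 : `|(s - s0) - (t - t0)| <= mesh N by rewrite ler_norml; apply/andP; split; lra.
have -> : u N i - u N i0 - (t - t0) *: l =
    (u N i - u N i0 - (s - s0) *: l) + ((s - s0) - (t - t0)) *: l.
  by apply/rowP => k; rewrite !mxE; ring.
apply: le_trans (ler_normD _ _) _; apply: lerD.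
  apply: le_trans main _; rewrite ler_pM2l //.
  rewrite -(subrK (t - t0) (s - s0)) addrC; apply: le_trans (ler_normD _ _) _.
  by rewrite lerD2l.
by rewrite normrZ ler_wpM2r.
Unshelve. all: by end_near. Qed.
End GridLimit.

(** * The problem with a bounded radial field *)

Lemma compact_bound {R : realType} {p q : nat} (S : topologicalType) (A : set S)
    (f : S -> 'M[R]_(p, q)) :
  compact A -> continuous f -> exists2 M : R, 0 < M & forall x, A x -> `|f x| <= M.
Proof.
move=> cA cf; have /compact_bounded[M [_ HM]] : compact (f @` A).
  by apply: continuous_compact => //; exact: continuous_subspaceT.
exists (`|M| + 1); first by rewrite ltr_wpDl.
move=> x Ax; apply: HM; last by exists x.
by rewrite (le_lt_trans (ler_norm M)) // ltrDl.
Qed.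

Section BoundedProblem.
Context {R : realType} {n : nat}.
Variables (phi psi gam : 'rV[R]_n -> 'rV[R]_n) (h : R -> 'rV[R]_n -> 'rV[R]_n).
Variables (C : set 'rV[R]_n) (nu : 'rV[R]_n -> 'rV[R]_n) (B : set 'rV[R]_n).
Variables (T K : R).
Hypothesis T0 : 0 < T.
Hypotheses (cphi : continuous phi) (cpsi : continuous psi).
Hypotheses (phiK : cancel phi psi) (psiK : cancel psi phi).
Hypothesis phi_par : forall x, exists2 k : R, 0 < k & phi x = k *: x.
Hypothesis cgam : continuous gam.
Hypothesis gam_par : forall w, exists k : R, gam w = k *: w.
Hypothesis gam_bounded : forall w, `|gam w| <= K.
Hypothesis ch : continuous (fun p : R * 'rV[R]_n => h p.1 p.2).
Hypotheses (C0 : C !=set0) (cC : compact C).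
Hypothesis C_convex : forall p q (t : R), C p -> C q -> 0 <= t <= 1 ->
  C (p + t *: (q - p)).
Hypothesis C_support : forall p q, C p -> B p -> C q -> dotv (nu p) (q - p) <= 0.
Hypothesis C_normal : forall p v, C p -> (forall q, C q -> 0 <= dotv v (q - p)) ->
  (B p -> 0 <= dotv (nu p) v) -> v = 0.
Hypothesis h_out : forall t p, 0 <= t <= T -> C p -> B p -> 0 <= dotv (nu p) (h t p).

Let psi_par w : exists2 k : R, 0 < k & psi w = k *: w.
Proof.
have [k k0] := phi_par (psi w); rewrite psiK => wE; exists k^-1.
  by rewrite invr_gt0.
by rewrite [in RHS]wE scalerA mulVf ?scale1r // gt_eqF.
Qed.

(** Damping near the origin keeps [gam w = k *: w] with [k] below the inverse of
    the mesh, which is what the sign argument for the discrete equation needs. *)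
Let damp (N : nat) (w : 'rV[R]_n) : R := Num.min 1 (`|w| / ((`|K| + 1) * mesh T N)).

Let damped N w : 'rV[R]_n := damp N w *: gam w.

Let K1 : 0 < `|K| + 1. Proof. by rewrite ltr_wpDl. Qed.

Let eta0 N : 0 < (`|K| + 1) * mesh T N.
Proof. by rewrite mulr_gt0 // mesh_gt0. Qed.

Let damp01 N w : 0 <= damp N w <= 1.
Proof. by rewrite ge_min lexx andbT le_min ler01 divr_ge0 // ltW. Qed.

Lemma damped_le N w : `|damped N w| <= `|gam w|.
Proof.
have /andP[d0 d1] := damp01 N w.
by rewrite normrZ ger0_norm // ler_piMl.
Qed.

Lemma damped_par N w : exists2 k : R, k <= (T / N.+1%:R)^-1 & damped N w = k *: w.
Proof.
have [k kE] := gam_par w; have [->|w0] := eqVneq w 0.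
  exists 0; first by rewrite invr_ge0 ltW // mesh_gt0.
  by rewrite /damped /damp normr0 mul0r min_r // !scale0r.
exists (damp N w * k); last by rewrite /damped kE scalerA.
have wpos : 0 < `|w| by rewrite normr_gt0.
have kw : `|k| * `|w| <= `|K| + 1.
  rewrite -normrZ -kE; apply: le_trans (gam_bounded w) _.
  by apply: le_trans (ler_norm K) _; rewrite lerDl.
have /andP[d0 d1] := damp01 N w.
apply: le_trans (ler_norm _) _; rewrite normrM (ger0_norm d0).
apply: (@le_trans _ _ (`|w| / ((`|K| + 1) * mesh T N) * `|k|)).
  by rewrite ler_wpM2r // ge_min lexx orbT.
rewrite mulrAC ler_pdivrMr // mulrC (le_trans kw) //.
by rewrite -/(mesh T N) mulrCA mulVf ?mulr1 // gt_eqF // mesh_gt0.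
Qed.

Lemma damped_continuous N : continuous (damped N).
Proof.
apply: continuous_scale => //.
pose c := ((`|K| + 1) * mesh T N)^-1; have c0 : 0 < c by rewrite invr_gt0.
apply: (lipschitz_continuous (k := c)) => // x y.
have : `| `|x| * c - `|y| * c| <= c * `|x - y|.
  by rewrite -mulrBl normrM (gtr0_norm c0) mulrC ler_pM2l // ler_dist_dist.
rewrite /damp -/c !ler_norml => /andP[? ?].
by apply/andP; split; case: (leP 1 (`|x| * c)); case: (leP 1 (`|y| * c)); lra.
Qed.

(** Away from the origin the damping is eventually inactive, and at the origin
    [gam] vanishes. *)
Lemma damped_limit (U : set_system nat) (UU : UltraFilter U) (w : 'rV[R]_n) (e : R) :
  \oo `<=` U -> 0 < e ->
  exists2 d, 0 < d & \forall N \near U, forall w', `|w' - w| <= d ->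
    `|damped N w' - gam w| <= e.
Proof.
move=> Uoo e0; have /cvgrPdist_le/(_ _ e0) := @cgam w.
move=> /nbhs_dist_ex[d d0 near_w].
have [w0|w0] := eqVneq w 0.
  exists (d / 2); first by rewrite divr_gt0.
  near=> N => w' w'd; have [k gam0] := gam_par w.
  have gw0 : gam w = 0 by rewrite gam0 w0 scaler0.
  rewrite gw0 subr0; apply: le_trans (damped_le N w') _.
  by rewrite -normrN -[- _]add0r -gw0; apply: near_w; rewrite distrC; lra.
have wpos : 0 < `|w| by rewrite normr_gt0.
exists (Num.min (d / 2) (`|w| / 2)); first by rewrite lt_min !divr_gt0.
near=> N => w'; rewrite le_min => /andP[w'd w'w].
have small : (`|K| + 1) * mesh T N <= `|w| / 2.
  rewrite mulrC -ler_pdivlMr //; near: N; apply: mesh_small => //.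
  by rewrite !divr_gt0.
have w'big : `|w| / 2 <= `|w'|.
  have := ler_distD w' w 0; rewrite !subr0 distrC; lra.
have -> : damped N w' = gam w'.
  rewrite /damped /damp min_l ?scale1r // ler_pdivlMr // mul1r.
  exact: le_trans small w'big.
by rewrite distrC; apply: near_w; rewrite distrC; lra.
Unshelve. all: by end_near. Qed.

(** Boundedness of [gam] makes the discrete momenta uniformly Lipschitz; that [xs]
    is periodic bounds their initial values. *)
Theorem bounded_problem_solution : exists x w : R -> 'rV[R]_n,
  [/\ forall t, 0 <= t <= T -> C (x t),
      x 0 = x T /\ w 0 = w T,
      has_velocity T x (fun t => psi (w t))
    & has_velocity T w (fun t => gam (w t) + h t (x t))].
Proof.
have ht t : continuous (h t).
  apply: (@continuous_comp_fun _ _ _ (fun p : 'rV[R]_n => (t, p))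
    (fun p : R * 'rV[R]_n => h p.1 p.2)) => //.
  by apply: continuous_pairing; [exact: continuous_const | exact: continuous_identity].
have grid N : exists xw : (nat -> 'rV[R]_n) * (nat -> 'rV[R]_n),
    [/\ forall j, C (xw.1 j),
      xw.1 N.+1 = xw.1 0 /\ xw.2 N.+1 = xw.2 0,
      forall j, xw.1 j.+1 - xw.1 j = mesh T N *: psi (xw.2 j)
    & forall j, (j < N.+1)%N -> xw.2 j.+1 - xw.2 j =
        mesh T N *: (damped N (xw.2 j.+1) + h (j.+1%:R * mesh T N) (xw.1 j.+1))].
  have [xs [ws ?]] := discrete_solution T0 cphi phiK phi_par (@damped_continuous N)
    (damped_par N) (fun t _ => ht t) C0 cC C_convex C_support C_normal h_out.
  by exists (xs, ws).
have [xw xwP] := choice grid; pose xs N := (xw N).1; pose ws N := (xw N).2.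
have Cxs N j : C (xs N j) by have [H _ _ _] := xwP N; exact: H.
have xs0 N : xs N N.+1 = xs N 0 by have [_ [H _] _ _] := xwP N.
have ws0 N : ws N N.+1 = ws N 0 by have [_ [_ H] _ _] := xwP N.
have xsS N j : xs N j.+1 - xs N j = mesh T N *: psi (ws N j).
  by have [_ _ H _] := xwP N; exact: H.
have wsS N j : (j < N.+1)%N -> ws N j.+1 - ws N j =
    mesh T N *: (damped N (ws N j.+1) + h (j.+1%:R * mesh T N) (xs N j.+1)).
  by have [_ _ _ H] := xwP N; exact: H.
have m0 N : 0 < mesh T N by exact: mesh_gt0.
have mN N : N.+1%:R * mesh T N = T by rewrite /mesh mulrC divfK.
have node N j : (j <= N.+1)%N -> 0 <= j%:R * mesh T N <= T.
  move=> jN; rewrite mulr_ge0 ?(ltW (m0 N)) //= -[leRHS](mN N).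
  by rewrite ler_pM2r // ler_nat.
have [H H0 Hh] : exists2 H : R, 0 < H & forall t p, 0 <= t <= T -> C p -> `|h t p| <= H.
  have cTC : compact (`[0, T]%classic `*` C).
    by apply: compact_setX => //; exact: segment_compact.
  have [H H0 HP] := compact_bound cTC ch; exists H => // t p tI Cp.
  by apply: (HP (t, p)); split=> //=; rewrite in_itv.
pose L : R := `|K| + H.
have L0 : 0 < L by rewrite ltr_wpDl ?normr_ge0.
have ws_step N j : (j < N.+1)%N -> `|ws N j.+1 - ws N j| <= L * mesh T N.
  move=> jN; rewrite wsS // normrZ (gtr0_norm (m0 N)) mulrC ler_pM2r //.
  apply: le_trans (ler_normD _ _) _; apply: lerD; last by rewrite Hh // node.
  by apply: le_trans (damped_le N _) _; apply: le_trans (gam_bounded _) (ler_norm K).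
have ws_dist N j : (j <= N.+1)%N -> `|ws N j - ws N 0| <= L * T.
  move=> jN; apply: le_trans (u_lipschitz T0 ws_step jN (leq0n _)) _.
  have /andP[j0 jT] := node N j jN.
  by rewrite mul0r subr0 ger0_norm // ler_pM2l.
(* otherwise every w_j, hence every psi (w_j), points to the same side as w_0 *)
have ws_start N : enorm (ws N 0) <= n%:R * (L * T).
  rewrite leNgt; apply/negP => big.
  have pos j : (j <= N.+1)%N -> 0 < dotv (psi (ws N j)) (ws N 0).
    move=> jN; have [k k0 ->] := psi_par (ws N j); rewrite dotvZl pmulr_rgt0 //.
    rewrite -(subrK (ws N 0) (ws N j)) dotvDl -sqr_enorm.
    have := normr_dotv (ws N j - ws N 0) (ws N 0).
    have small : enorm (ws N j - ws N 0) < enorm (ws N 0).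
      apply: le_lt_trans (enorm_le_norm _) _; apply: le_lt_trans big.
      by rewrite ler_wpM2l // ws_dist.
    rewrite ler_norml => /andP[lo _].
    have e0 : 0 < enorm (ws N 0) by apply: le_lt_trans small; exact: enorm_ge0.
    by rewrite expr2; nra.
  have incr j : (j <= N)%N -> dotv (xs N 0) (ws N 0) < dotv (xs N j.+1) (ws N 0).
    elim: j => [_|j IH jN]; rewrite -subr_gt0 -dotvBl.
      by rewrite xsS dotvZl mulr_gt0 // pos.
    rewrite -(subrK (xs N j.+1) (xs N j.+2)) -addrA dotvDl xsS dotvZl.
    apply: addr_gt0; first by rewrite mulr_gt0 // pos // ltnW.
    by rewrite dotvBl subr_gt0 IH // ltnW.
  by have := incr N (leqnn N); rewrite xs0 ltxx.
pose W : R := (n%:R + 1) * (L * T).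
have ws_le N j : (j <= N.+1)%N -> `|ws N j| <= W.
  move=> jN; rewrite -(subrK (ws N 0) (ws N j)) addrC.
  apply: le_trans (ler_normD _ _) _; rewrite /W mulrDl mul1r; apply: lerD.
    exact: le_trans (norm_le_enorm _) (ws_start N).
  exact: ws_dist.
have [P P0 psiP] : exists2 P : R, 0 < P & forall v, `|v| <= W -> `|psi v| <= P.
  have cW : compact [set v : 'rV[R]_n | `|v| <= W].
    apply: bounded_closed_compact.
      by exists W; split; [exact: num_real | move=> M /ltW WM v /= /le_trans; apply].
    apply: (@preimage_closed _ _ (fun v : 'rV[R]_n => `|v|) [set r | r <= W]).
      by move=> ? _; exact: norm_continuous.
    exact: closed_le.
  by have [P P0 ?] := compact_bound cW cpsi; exists P.
have xs_step N j : (j < N.+1)%N -> `|xs N j.+1 - xs N j| <= P * mesh T N.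
  move=> jN; rewrite xsS normrZ (gtr0_norm (m0 N)) mulrC ler_pM2r // psiP //.
  by rewrite ws_le // ltnW.
have [M _ CM] := compact_bound (f := fun v : 'rV[R]_n => v) cC continuous_identity.
have xs_le N j : (j <= N.+1)%N -> `|xs N j| <= M by move=> _; exact: CM.
have [U UU Uoo] := ultra_oo; have PU := @ultra_proper _ _ UU.
have [x x_lim] := step_limit T0 xs_le.
have [w w_lim] := step_limit T0 ws_le.
have T0T : 0 <= T <= T by rewrite lexx ltW.
have I0T : 0 <= (0 : R) <= T by rewrite lexx ltW.
have idx0 N : cell_index T N 0 = 0 by rewrite /cell_index mul0r truncn0.
have idxT N : cell_index T N T = N.+1.
  rewrite /cell_index; apply: truncn_def; rewrite /mesh invf_div mulrCA.
  by rewrite divff ?gt_eqF // mulr1 lexx ltr_nat ltnSn.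
exists x, w; split.
- move=> t tI.
  have clC : closed C by apply: compact_closed => //; exact: norm_hausdorff.
  apply: (@closed_cvg _ _ U _ (fun N => xs N (cell_index T N t)) C clC _ _ (x_lim t tI)).
  by apply: nearW => N; exact: Cxs.
- split.
    have := x_lim _ T0T; have := x_lim _ I0T.
    under eq_fun do rewrite idx0; under [X in _ -> X @ _ --> _ -> _]eq_fun do rewrite idxT xs0.
    exact: cvg_unique.
  have := w_lim _ T0T; have := w_lim _ I0T.
  under eq_fun do rewrite idx0; under [X in _ -> X @ _ --> _ -> _]eq_fun do rewrite idxT ws0.
  exact: cvg_unique.
- move=> t tI; apply: (step_limit_velocity T0 Uoo x_lim tI) => e e0.
  have /nbhs_dist_ex[d d0 near_w] : nbhs (w t) [set v | `|psi (w t) - psi v| <= e].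
    by have /cvgrPdist_le/(_ _ e0) := @cpsi (w t).
  have d2 : 0 < d / 2 by rewrite divr_gt0.
  have [r r0 near_t] := near_step_limit T0 Uoo ws_step w_lim tI d2.
  exists r => //; apply: filterS near_t => N near_t j jN jt.
  rewrite xsS -scalerBr normrZ (gtr0_norm (m0 N)) mulrC ler_pM2r // distrC.
  apply: near_w; rewrite distrC; apply: le_lt_trans (near_t j (ltnW jN) jt) _; lra.
move=> t tI; apply: (step_limit_velocity T0 Uoo w_lim tI) => e e0.
have e2 : 0 < e / 2 by rewrite divr_gt0.
have [dg dg0 near_gam] := @damped_limit U UU (w t) _ Uoo e2.
have /nbhs_dist_ex[dh dh0 near_h] :
    nbhs (t, x t) [set p : R * 'rV[R]_n | `|h t (x t) - h p.1 p.2| <= e / 2].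
  by have /cvgrPdist_le/(_ _ e2) := @ch (t, x t).
have dh2 : 0 < dh / 2 by rewrite divr_gt0.
have [rw rw0 near_tw] := near_step_limit T0 Uoo ws_step w_lim tI dg0.
have [rx rx0 near_tx] := near_step_limit T0 Uoo xs_step x_lim tI dh2.
pose r := Num.min (Num.min rw rx) dh / 4.
have r0 : 0 < r by rewrite divr_gt0 // !lt_min rw0 rx0 dh0.
have [rrw rrx rdh] : [/\ 4 * r <= rw, 4 * r <= rx & 4 * r <= dh].
  have -> : 4 * r = Num.min (Num.min rw rx) dh by rewrite /r; field.
  by split; rewrite !ge_min lexx ?orbT.
exists r => //.
near=> N => j jN jt.
rewrite wsS // -scalerBr normrZ (gtr0_norm (m0 N)) mulrC ler_pM2r //.
have mr : mesh T N <= r by near: N; exact: mesh_small.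
have jt' : `|j.+1%:R * mesh T N - t| <= 2 * r.
  by rewrite -natr1 mulrDl mul1r; move: jt; rewrite !ler_norml => /andP[? ?];
    have := m0 N; move=> ?; apply/andP; split; lra.
have near_tw' : `|ws N j.+1 - w t| <= dg.
  have near_N : forall j, (j <= N.+1)%N -> `|j%:R * mesh T N - t| <= rw ->
      `|ws N j - w t| <= dg by near: N.
  by apply: near_N => //; lra.
have near_tx' : `|xs N j.+1 - x t| <= dh / 2.
  have near_N : forall j, (j <= N.+1)%N -> `|j%:R * mesh T N - t| <= rx ->
      `|xs N j - x t| <= dh / 2 by near: N.
  by apply: near_N => //; lra.
rewrite opprD addrACA (splitr e); apply: le_trans (ler_normD _ _) _; apply: lerD.
  have near_N : forall w', `|w' - w t| <= dg ->
      `|damped N w' - gam (w t)| <= e / 2 by near: N.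
  exact: near_N.
rewrite distrC; apply: (near_h (j.+1%:R * mesh T N, xs N j.+1)).
rewrite prod_normE /= gt_max; apply/andP; split; rewrite distrC; lra.
Unshelve. all: by end_near. Qed.
End BoundedProblem.

(** * Curves with a velocity *)

Lemma is_derive_estimate {R : realType} (W : normedModType R) (f : R -> W)
    (t : R) (l : W) :
  (forall e : R, 0 < e -> exists2 d : R, 0 < d &
     forall s, `|s - t| < d -> `|f s - f t - (s - t) *: l| <= e * `|s - t|) ->
  is_derive t 1 f l.
Proof.
move=> H.
have lim : h^-1 *: ((f \o shift t) (h *: (1 : R)) - f t) @[h --> (0 : R)^'] --> l.
  apply/cvgrPdist_le => e e0; have [d d0 Hd] := H e e0.
  apply/nbhs_ballP; exists d => //= h; rewrite /ball /= sub0r normrN => hd h0.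
  have := Hd (h + t); rewrite addrK => /(_ hd) Hh.
  rewrite /= [h *: (1 : R)]mulr1.
  have -> : l - h^-1 *: (f (h + t) - f t) = - (h^-1 *: (f (h + t) - f t - h *: l)).
    by rewrite [in RHS]scalerBr scalerA mulVf // scale1r opprB.
  by rewrite normrN normrZ normfV mulrC ler_pdivrMr ?normr_gt0.
by apply: DeriveDef; [apply/cvg_ex; exists l | exact: cvg_lim lim].
Qed.

Section Velocity.
Context {R : realType} {n : nat} (T : R).
Implicit Types f df : R -> 'rV[R]_n.

Lemma velocity_is_derive f df t : has_velocity T f df -> 0 < t < T ->
  is_derive t 1 f (df t).
Proof.
move=> fv /andP[t0 tT]; apply: is_derive_estimate => e e0.
have tI : 0 <= t <= T by rewrite !ltW.
have [d d0 Hd] := fv t tI e e0.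
exists (Num.min d (Num.min t (T - t))).
  by rewrite !lt_min d0 t0 subr_gt0.
move=> s; rewrite !lt_min !ltr_norml => /and3P[/andP[? ?] /andP[? ?] /andP[? ?]].
apply: Hd; first by apply/andP; split; lra.
by rewrite ltr_norml; apply/andP; split; lra.
Qed.

Lemma velocity_continuous f df : has_velocity T f df ->
  {within `[0, T], continuous f}.
Proof.
move=> fv; apply/subspace_continuousP => t; rewrite /= in_itv /= => tI.
have [d d0 Hd] := fv t tI 1 ltr01.
apply/cvgrPdist_le => e e0.
have L0 : 0 < 1 + `|df t| by rewrite ltr_wpDr.
have : \forall s \near t, `|t - s| < Num.min d (e / (1 + `|df t|)).
  by apply: nbhs_dist_lt; rewrite lt_min d0 divr_gt0.
apply: filterS => s; rewrite lt_min => /andP[tsd tse]; rewrite /= in_itv /= => sI.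
rewrite distrC in tsd; have := Hd s sI tsd; rewrite mul1r => Hs.
rewrite distrC -(subrK ((s - t) *: df t) (f s - f t)).
apply: le_trans (ler_normD _ _) _; rewrite normrZ.
apply: (@le_trans _ _ (`|s - t| * (1 + `|df t|))); first by rewrite mulrDr mulr1 lerD2r.
by rewrite -ler_pdivlMr // distrC ltW.
Qed.

Lemma velocity_quotient f df t : has_velocity T f df -> t \in `[0, T] ->
  (s - t)^-1 *: (f s - f t) @[s --> within `[0, T] t^'] --> df t.
Proof.
move=> fv; rewrite in_itv /= => tI; apply/cvgrPdist_le => e e0.
have [d d0 Hd] := fv t tI e e0.
have : \forall s \near t, `|t - s| < d by exact: nbhs_dist_lt.
rewrite /within /= /dnbhs /within /=; apply: filterS => s ts st.
rewrite in_itv /= => sI; rewrite distrC in ts.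
have st0 : s - t != 0 by rewrite subr_eq0.
have -> : df t - (s - t)^-1 *: (f s - f t) =
    - ((s - t)^-1 *: (f s - f t - (s - t) *: df t)).
  by rewrite [in RHS]scalerBr scalerA mulVf // scale1r opprB.
by rewrite normrN normrZ normfV mulrC ler_pdivrMr ?normr_gt0 //; exact: Hd.
Qed.
End Velocity.

Lemma nondecreasing_of_derive {R : realType} (T : R) (f df : R -> R) :
  {within `[0, T], continuous f} ->
  (forall t, 0 < t < T -> is_derive t 1 f (df t)) ->
  (forall t, 0 < t < T -> 0 <= df t) ->
  forall a b, 0 <= a -> a <= b -> b <= T -> f a <= f b.
Proof.
move=> cf fd df0 a b a0; rewrite le_eqVlt => /predU1P[->//|ab] bT.
have cab : {within `[a, b], continuous f}.
  by apply: continuous_subspaceW cf; apply: subset_itv; rewrite bnd_simp.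
have dab t : t \in `]a, b[ -> is_derive t 1 f (df t).
  by rewrite in_itv /= => /andP[? ?]; apply: fd; apply/andP; split; lra.
have [t] := MVT ab dab cab; rewrite in_itv /= => /andP[? ?] E.
by rewrite -subr_ge0 E mulr_ge0 ?subr_ge0 ?(ltW ab) // df0 //; apply/andP; split; lra.
Qed.

(** * Truncation of the field *)

Lemma pospart_sqr_estimate {R : realFieldType} (y k : R) :
  `|Num.max 0 (y + k) ^+ 2 - Num.max 0 y ^+ 2 - 2 * Num.max 0 y * k| <= k ^+ 2.
Proof.
have k2 : 0 <= k ^+ 2 := sqr_ge0 k.
have yk2 : 0 <= (y + k) ^+ 2 := sqr_ge0 _.
rewrite ler_norml; case: (leP 0 (y + k)) => yk; case: (leP 0 y) => y0.
- by apply/andP; split; lra.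
- have : 0 <= - y * (y + k) by rewrite mulr_ge0 // ltW // oppr_gt0.
  have : 0 <= - y * k by rewrite mulr_ge0 //; lra.
  by move=> *; apply/andP; split; lra.
- have : 0 <= - (y + k) * (y - k) by rewrite mulr_ge0 //; lra.
  have : 0 <= y * - k by rewrite mulr_ge0 //; lra.
  by move=> *; apply/andP; split; lra.
by apply/andP; split; lra.
Qed.

(** The radial cut-off [w |-> q(|w|^2) w]: identity on the ball [|w|^2 <= S],
    with bounded range, and such that [2 s q'(s)] is bounded independently of
    [S]. *)
Section Cutoff.
Context {R : realType} (S : R).
Hypothesis S0 : 0 < S.

Let excess (s : R) : R := Num.max 0 (s / S - 1).

Definition cutoff (s : R) : R := (1 + excess s ^+ 2)^-1.

Definition cutoff' (s : R) : R := - (2 * excess s / S) / (1 + excess s ^+ 2) ^+ 2.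

Let excess_ge0 s : 0 <= excess s. Proof. by rewrite le_max lexx. Qed.

Let den_gt0 s : 0 < 1 + excess s ^+ 2. Proof. by rewrite ltr_wpDr // sqr_ge0. Qed.

Lemma cutoff_id s : s <= S -> cutoff s = 1 /\ cutoff' s = 0.
Proof.
move=> sS; have e0 : excess s = 0.
  by rewrite /excess max_l // subr_le0 ler_pdivrMr // mul1r.
by rewrite /cutoff /cutoff' e0 expr0n addr0 invr1 mulr0 !mul0r oppr0 mul0r.
Qed.

Let excess_sqr_derive (s : R) : is_derive s 1 (fun r => excess r ^+ 2) (2 * excess s / S).
Proof.
apply: is_derive_estimate => e e0; exists (e * S ^+ 2).
  by rewrite mulr_gt0 ?exprn_gt0.
move=> r rs; set h := r - s.
have rE : r / S - 1 = (s / S - 1) + h / S by rewrite /h; field; rewrite gt_eqF.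
have sq : `|excess r ^+ 2 - excess s ^+ 2 - h * (2 * excess s / S)| <= (h / S) ^+ 2.
  have -> : h * (2 * excess s / S) = 2 * excess s * (h / S) by field; rewrite gt_eqF.
  by rewrite /excess rE; exact: pospart_sqr_estimate.
rewrite [_ *: _]/(_ * _); apply: le_trans sq _.
rewrite exprMn exprVn ler_pdivrMr ?exprn_gt0 // -[h ^+ 2]real_normK ?num_real //.
rewrite expr2 mulrAC ler_wpM2r // ltW //.
Qed.

Lemma cutoff_derive (s : R) : is_derive s 1 cutoff (cutoff' s).
Proof.
have [dE dEE] := excess_sqr_derive s.
have D1 : is_derive s 1 (fun r => 1 + excess r ^+ 2) (2 * excess s / S).
  have := is_deriveD (is_derive_cst (1 : R) s 1) (excess_sqr_derive s).
  by rewrite add0r.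
have [d1 d1E] := D1; have ne : 1 + excess s ^+ 2 != 0 by rewrite gt_eqF.
apply: DeriveDef; first exact: derivableV.
rewrite deriveV // d1E /cutoff' /GRing.scale /=.
by rewrite mulrC mulrN mulNr.
Qed.

Lemma cutoff_range s : 0 <= cutoff s <= 1.
Proof.
by rewrite invr_ge0 ltW //= invf_le1 // lerDl sqr_ge0.
Qed.

Lemma cutoff_bounded s : 0 <= s -> cutoff s ^+ 2 * s <= 2 * S.
Proof.
move=> s0; rewrite /cutoff exprVn mulrC ler_pdivrMr ?exprn_gt0 //.
have sv : s <= S * (1 + excess s).
  rewrite mulrC -ler_pdivrMr // -lerBlDl le_max lexx orbT //.
apply: le_trans sv _; rewrite -mulrA mulrCA ler_pM2l //.
have := excess_ge0 s; set v := excess s; nra.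
Qed.

Lemma cutoff'_bounded s : 0 <= s -> 2 * `|cutoff' s| * s <= 8.
Proof.
move=> s0; rewrite /cutoff'; set v := excess s.
have v0 : 0 <= v := excess_ge0 s.
have D0 : 0 < 1 + v ^+ 2 := den_gt0 s.
have sv : s <= S * (1 + v) by rewrite mulrC -ler_pdivrMr // -lerBlDl le_max lexx orbT.
rewrite normrM normrN normfV (ger0_norm (_ : 0 <= 2 * v / S)); last first.
  by apply: divr_ge0; [apply: mulr_ge0 | exact: ltW].
rewrite ger0_norm ?sqr_ge0 //.
have -> : 2 * (2 * v / S / (1 + v ^+ 2) ^+ 2) * s = 4 * v * (s / S) / (1 + v ^+ 2) ^+ 2.
  by field; rewrite (gt_eqF S0) gt_eqF // den_gt0.
have sS : s / S <= 1 + v by rewrite ler_pdivrMr // mulrC.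
rewrite ler_pdivrMr ?exprn_gt0 //.
apply: (@le_trans _ _ (4 * v * (1 + v))); first by apply: ler_wpM2l => //; exact: mulr_ge0.
have := sqr_ge0 (v - 1); have := sqr_ge0 (v ^+ 2); have := sqr_ge0 v; lra.
Qed.

Lemma cutoff_continuous : continuous cutoff.
Proof.
move=> s; apply: differentiable_continuous; apply/derivable1_diffP.
by case: (cutoff_derive s).
Qed.

Lemma cutoff'_continuous : continuous cutoff'.
Proof.
have ce : continuous excess.
  apply: (lipschitz_continuous (k := S^-1)) => [|x y]; first by rewrite invr_gt0.
  have : `|x / S - y / S| <= S^-1 * `|x - y|.
    by rewrite -mulrBl normrM [`|S^-1|]gtr0_norm ?invr_gt0 // mulrC.
  rewrite !ler_norml => /andP[? ?]; rewrite /excess.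
  by apply/andP; split; case: (leP 0 (x / S - 1)) => ?; case: (leP 0 (y / S - 1)) => ?; lra.
move=> s; apply: cvgM.
  apply: cvgN; apply: cvgMl; apply: cvgMr; exact: ce.
apply: cvgV; first by rewrite gt_eqF // exprn_gt0.
apply: (cvg_comp (fun s => 1 + excess s ^+ 2) (fun x : R => x ^+ 2)).
  apply: cvgD; first exact: cvg_cst.
  apply: (cvg_comp excess (fun x : R => x ^+ 2) (ce s)); exact: exprn_continuous.
exact: exprn_continuous.
Qed.
End Cutoff.

Lemma is_derive_scale {R : realType} {n : nat} (k : R -> R) (f : R -> 'rV[R]_n)
    (t dk : R) (df : 'rV[R]_n) :
  is_derive t 1 k dk -> is_derive t 1 f df ->
  is_derive t 1 (fun s => k s *: f s) (k t *: df + dk *: f t).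
Proof.
move=> Dk Df.
have Dij i : is_derive t 1 (fun s => (k s *: f s) 0 i) ((k t *: df + dk *: f t) 0 i).
  have -> : (fun s => (k s *: f s) 0 i) = k * (fun s => f s 0 i).
    by apply/funext => s; rewrite mxE.
  have := is_deriveM Dk (is_derive_coord i Df); congr is_derive.
  by rewrite !mxE /GRing.scale /= [dk * _]mulrC.
have dkf : derivable (fun s => k s *: f s) t 1.
  by apply/derivable_mxP => i j; rewrite (ord1 i); case: (Dij j).
apply: DeriveDef => //; rewrite derive_mx //; apply/rowP => j.
by rewrite mxE; case: (Dij j).
Qed.

Section Truncation.
Context {R : realType} {n : nat} (S : R).
Hypothesis S0 : 0 < S.
Variables (ghat : 'rV[R]_n -> 'rV[R]_n) (G : 'rV[R]_n -> R) (Bc : R).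
Hypothesis cghat : continuous ghat.
Hypothesis ghat_par : forall w, exists k : R, ghat w = k *: w.
Hypothesis G1 : class_C1 G.
Hypothesis Bc0 : 0 <= Bc.
Hypothesis ghatG : forall w, enorm (ghat w - grad G w) <= Bc.

Definition pull (w : 'rV[R]_n) : 'rV[R]_n := cutoff S (dotv w w) *: w.

Definition truncated (w : 'rV[R]_n) : 'rV[R]_n :=
  (cutoff S (dotv w w) + 2 * dotv w w * cutoff' S (dotv w w)) *: ghat (pull w).

Let cvv : continuous (fun w : 'rV[R]_n => dotv w w).
Proof. by apply: continuous_dotv; exact: continuous_identity. Qed.

Lemma pull_continuous : continuous pull.
Proof.
apply: continuous_scale; last exact: continuous_identity.
exact: (@continuous_comp_fun _ _ _ (fun w : 'rV[R]_n => dotv w w) (cutoff S) cvv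
  (cutoff_continuous S0)).
Qed.

Lemma truncated_continuous : continuous truncated.
Proof.
apply: continuous_scale; last first.
  exact: (@continuous_comp_fun _ _ _ pull ghat pull_continuous cghat).
apply: continuous_addr.
  exact: (@continuous_comp_fun _ _ _ (fun w : 'rV[R]_n => dotv w w) (cutoff S) cvv
    (cutoff_continuous S0)).
apply: continuous_mul; first by apply: continuous_mul => //; exact: continuous_const.
exact: (@continuous_comp_fun _ _ _ (fun w : 'rV[R]_n => dotv w w) (cutoff' S) cvv
    (cutoff'_continuous S0)).
Qed.

Lemma truncated_par w : exists k : R, truncated w = k *: w.
Proof.
have [k kE] := ghat_par (pull w).
by rewrite /truncated kE /pull !scalerA; eexists.
Qed.

Lemma truncated_id w : dotv w w <= S -> truncated w = ghat w.
Proof.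
move=> /cutoff_id -/(_ S0) [c1 c0].
by rewrite /truncated /pull c1 c0 mulr0 addr0 !scale1r.
Qed.

Lemma truncated_bounded : exists K : R, forall w, `|truncated w| <= K.
Proof.
have cB : compact [set v : 'rV[R]_n | `|v| <= 2 * S + 1].
  apply: bounded_closed_compact.
    exists (2 * S + 1); split; first exact: num_real.
    by move=> M /ltW SM v /= /le_trans; apply.
  apply: (@preimage_closed _ _ (fun v : 'rV[R]_n => `|v|) [set r | r <= 2 * S + 1]).
    by move=> ? _; exact: norm_continuous.
  exact: closed_le.
have [K K0 HK] := compact_bound cB cghat; exists (9 * K) => w.
have s0 := dotvv_ge0 w; rewrite normrZ; apply: ler_pM => //.
  have /andP[c0 c1] := cutoff_range S (dotv w w).
  have := cutoff'_bounded S0 s0.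
  have -> : 2 * `|cutoff' S (dotv w w)| * dotv w w =
      `|2 * dotv w w * cutoff' S (dotv w w)|.
    by rewrite !normrM (ger0_norm s0) normr_nat mulrAC.
  by rewrite !ler_norml => /andP[? ?]; apply/andP; split; lra.
apply: HK; apply: le_trans (norm_le_enorm _) _.
have : enorm (pull w) ^+ 2 <= 2 * S.
  by rewrite sqr_enorm /pull dotvZl dotvZr mulrA -expr2 cutoff_bounded.
have := sqr_ge0 (enorm (pull w) - 1); have := enorm_ge0 (pull w); nra.
Qed.

(** The field is radial and, up to a bounded error, a gradient; composing the
    potential with the radial map [pull] keeps both properties. *)
Lemma energy_derive (w : R -> 'rV[R]_n) (t : R) (dw : 'rV[R]_n) :
  is_derive t 1 w dw ->
  exists2 E : R, is_derive t 1 (fun s => G (pull (w s))) E &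
    dotv (truncated (w t)) dw - 9 * Bc * enorm dw <= E.
Proof.
move=> Dw; set s := dotv (w t) (w t); set q := cutoff S s; set q' := cutoff' S s.
have Ds : is_derive t 1 (fun r => dotv (w r) (w r)) (dotv dw (w t) + dotv (w t) dw).
  exact: is_derive_dotv.
set ds := dotv dw (w t) + dotv (w t) dw in Ds.
have Dq : is_derive t 1 (fun r => cutoff S (dotv (w r) (w r))) (q' * ds).
  exact: (@is_derive1_comp _ (cutoff S) (fun r => dotv (w r) (w r)) t _ _
            (cutoff_derive S0 _) Ds).
have Dp : is_derive t 1 (fun r => pull (w r)) (q *: dw + (q' * ds) *: w t).
  exact: is_derive_scale.
exists (dotv (grad G (pull (w t))) (q *: dw + (q' * ds) *: w t)).
  by apply: is_derive_along; case: G1.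
have [k kE] := ghat_par (pull (w t)).
have := ghatG (pull (w t)); set b := ghat (pull (w t)) - grad G (pull (w t)) => bB.
have -> : grad G (pull (w t)) = ghat (pull (w t)) - b by rewrite /b opprB addrC subrK.
have s0 : 0 <= s := dotvv_ge0 _.
have /andP[q0 q1] : 0 <= q <= 1 := cutoff_range S s.
have q'8 : 2 * `|q'| * s <= 8 := cutoff'_bounded S0 s0.
have dsE : ds = 2 * dotv (w t) dw by rewrite /ds (dotvC dw); ring.
have e0 := enorm_ge0 dw.
have b1 : `|dotv b dw| <= Bc * enorm dw.
  by apply: le_trans (normr_dotv _ _) _; rewrite ler_wpM2r.
have b2 : `|dotv b (w t)| * `|dotv (w t) dw| <= Bc * enorm dw * s.
  apply: (@le_trans _ _ ((Bc * enorm (w t)) * (enorm (w t) * enorm dw))).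
    apply: ler_pM => //; last exact: normr_dotv.
    by apply: le_trans (normr_dotv _ _) _; rewrite ler_wpM2r // enorm_ge0.
  by rewrite /s -sqr_enorm; lra.
have err : `|q * dotv b dw + (q' * ds) * dotv b (w t)| <= 9 * Bc * enorm dw.
  apply: le_trans (ler_normD _ _) _.
  have -> : 9 * Bc * enorm dw = Bc * enorm dw + 8 * (Bc * enorm dw) by ring.
  apply: lerD; first by rewrite normrM (ger0_norm q0); apply: le_trans b1; rewrite ler_piMl.
  rewrite dsE (normrM (q' * _)) (normrM q') (normrM 2) normr_nat.
  apply: (@le_trans _ _ (2 * `|q'| * (Bc * enorm dw * s))).
    have : 2 * `|q'| * (`|dotv b (w t)| * `|dotv (w t) dw|) <= 2 * `|q'| * (Bc * enorm dw * s).
      by rewrite ler_wpM2l // mulr_ge0.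
    by lra.
  have -> : 2 * `|q'| * (Bc * enorm dw * s) = (2 * `|q'| * s) * (Bc * enorm dw) by ring.
  by rewrite ler_wpM2r // mulr_ge0.
have main : dotv (truncated (w t)) dw =
    dotv (ghat (pull (w t))) (q *: dw + (q' * ds) *: w t).
  rewrite /truncated kE /pull -/s -/q -/q' !dotvE dsE -/s; ring.
rewrite main dotvBl lerD2l lerN2 dotvDr !dotvZr.
exact: le_trans (ler_norm _) err.
Qed.
End Truncation.

(** * A priori bound and conclusion *)

Section AprioriBound.
Context {R : realType} {n : nat} (S : R).
Hypothesis S0 : 0 < S.
Variables (ghat : 'rV[R]_n -> 'rV[R]_n) (G : 'rV[R]_n -> R) (Bc : R).
Hypothesis ghat_par : forall w, exists k : R, ghat w = k *: w.
Hypothesis G1 : class_C1 G.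
Hypothesis Bc0 : 0 <= Bc.
Hypothesis ghatG : forall w, enorm (ghat w - grad G w) <= Bc.
Variables (T H : R) (psi : 'rV[R]_n -> 'rV[R]_n) (x w b : R -> 'rV[R]_n).
Hypothesis T0 : 0 < T.
Hypothesis H0 : 0 < H.
Hypothesis psi_par : forall w, exists2 k : R, 0 < k & psi w = k *: w.
Hypothesis x_vel : has_velocity T x (fun t => psi (w t)).
Hypothesis w_vel : has_velocity T w (fun t => truncated S ghat (w t) + b t).
Hypotheses (x0T : x 0 = x T) (w0T : w 0 = w T).
Hypothesis b_le : forall t : R, 0 <= t <= T -> enorm (b t) <= H.

Let c : R := H + 9 * Bc.

Let c0 : 0 < c. Proof. by rewrite ltr_wpDr // mulr_ge0. Qed.

Let E (t : R) : R := G (pull S (w t)).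

(** The energy inequality [E' >= |w'|^2 - c |w'| >= c |w'| - c^2], integrated
    against a fixed direction. *)
Lemma energy_monotone u s t : enorm u <= c -> 0 <= s -> s <= t -> t <= T ->
  E s + s * c ^+ 2 + dotv (w s) u <= E t + t * c ^+ 2 + dotv (w t) u.
Proof.
move=> uc; pose Phi (r : R) : R := E r + (0 + r *: c ^+ 2) + dotv (w r) u.
have PhiE r : E r + r * c ^+ 2 + dotv (w r) u = Phi r by rewrite /Phi add0r.
rewrite !PhiE; have cw := velocity_continuous w_vel.
have cG : continuous G.
  by move=> v; apply: differentiable_continuous; case: G1 => + _; exact.
have cPhi : {within `[0, T], continuous Phi}.
  apply: continuous_addr.
    apply: continuous_addr.
      apply: (@continuous_comp_fun (subspace `[0, T]) _ _ (fun r => pull S (w r)) G) => //.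
      exact: (@continuous_comp_fun (subspace `[0, T]) _ _ w (pull S) cw (pull_continuous S0)).
    apply: continuous_subspaceT => r; apply: differentiable_continuous.
    by apply/derivable1_diffP; have [] := is_derive_line (0 : R) (c ^+ 2) r.
  by apply: continuous_dotv => //; exact: continuous_const.
have dPhi r : 0 < r < T -> exists2 l, is_derive r 1 Phi l & 0 <= l.
  move=> rI; have Dw := velocity_is_derive w_vel rI.
  set dw := truncated S ghat (w r) + b r in Dw.
  have [l Dl lE] := energy_derive S0 ghat_par G1 Bc0 ghatG Dw.
  have Du := is_derive_dotv Dw (is_derive_cst u r 1).
  exists (l + c ^+ 2 + (dotv dw u + dotv (w r) 0)).
    apply: is_deriveD; apply: is_deriveD => //; exact: is_derive_line.
  rewrite dotv0r addr0.
  have rI' : 0 <= r <= T by case/andP: rI => *; rewrite !ltW.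
  have trE : truncated S ghat (w r) = dw - b r by rewrite /dw addrK.
  have b_dw : dotv (b r) dw <= H * enorm dw.
    by apply: le_trans (dotv_le _ _) _; rewrite ler_wpM2r ?enorm_ge0 // b_le.
  have u_dw : - (c * enorm dw) <= dotv dw u.
    have := normr_dotv dw u; rewrite ler_norml => /andP[lo _]; apply: le_trans lo.
    by rewrite lerN2 mulrC ler_wpM2r ?enorm_ge0.
  move: lE; rewrite trE dotvBl -sqr_enorm => lE.
  have := sqr_ge0 (enorm dw - c); rewrite /c in u_dw *; nra.
apply: (nondecreasing_of_derive (df := fun r => 'D_1 Phi r) cPhi) => r rI.
  by have [l [dl _] _] := dPhi r rI; exact: derivableP.
by have [l [_ ->]] := dPhi r rI.
Qed.

(** Use the energy inequality on [[0, t]] against [- u] and on [[t, T]] against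
    [u]: periodicity cancels the energies. *)
Lemma oscillation_bound t : 0 <= t <= T -> enorm (w t - w 0) <= c * T / 2.
Proof.
move=> /andP[t0 tT]; have [->|d0] := eqVneq (w t - w 0) 0.
  by rewrite /enorm dotv0l sqrtr0 divr_ge0 // mulr_ge0 // ltW.
set d := w t - w 0 in d0 *.
have e0 : 0 < enorm d by rewrite sqrtr_gt0 dotvv_gt0.
pose u := (c / enorm d) *: d.
have uE : enorm u = c.
  by rewrite enormZ ger0_norm ?divr_ge0 ?enorm_ge0 ?(ltW c0) // divfK // gt_eqF.
have du : dotv d u = c * enorm d.
  by rewrite dotvZr -sqr_enorm expr2 mulrA divfK // gt_eqF.
have E1 : E 0 + 0 * c ^+ 2 + dotv (w 0) (- u) <= E t + t * c ^+ 2 + dotv (w t) (- u).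
  by apply: energy_monotone; rewrite // enormN uE.
have E2 : E t + t * c ^+ 2 + dotv (w t) u <= E T + T * c ^+ 2 + dotv (w T) u.
  by apply: energy_monotone; rewrite // uE.
have ET : E T = E 0 by rewrite /E w0T.
rewrite -w0T ET in E2; move: du; rewrite /d dotvBl -/d => du.
rewrite ler_pdivlMr // -(ler_pM2l c0).
move: E1; rewrite !dotvNr => E1; nra.
Qed.

(** By Rolle's theorem some [x'(z)], hence also [w z], is orthogonal to [w 0]; then
    the distance from [w z] to [w 0] is at least the length of [w 0]. *)
Lemma momentum_bound t : 0 <= t <= T -> enorm (w t) <= c * T.
Proof.
move=> tI; have cf : {within `[0, T], continuous (fun s => dotv (x s) (w 0))}.
  apply: continuous_dotv; first exact: velocity_continuous x_vel.
  exact: continuous_const.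
have Df s : 0 < s < T -> is_derive s 1 (fun s => dotv (x s) (w 0))
    (dotv (psi (w s)) (w 0) + dotv (x s) 0).
  move=> sI.
  exact: (is_derive_dotv (velocity_is_derive x_vel sI) (is_derive_cst (w 0) s 1)).
have [s|z] := Rolle T0 _ cf (congr1 (fun v => dotv v (w 0)) x0T).
  by rewrite in_itv /= => /Df[].
rewrite in_itv /= => zI [_ Dz0]; have [_] := Df z zI.
rewrite Dz0 dotv0r addr0 => /esym; have [k k0 ->] := psi_par (w z).
rewrite dotvZl => /eqP; rewrite mulf_eq0 gt_eqF //= => /eqP ortho.
have zI' : 0 <= z <= T by case/andP: zI => *; rewrite !ltW.
have w0_le : enorm (w 0) <= c * T / 2.
  apply: le_trans (oscillation_bound zI').
  rewrite -(@ler_pXn2r _ 2) ?nnegrE ?enorm_ge0 // !sqr_enorm !dotvE ortho.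
  by rewrite (dotvC (w 0) (w z)) ortho; have := dotvv_ge0 (w z); lra.
rewrite -(subrK (w 0) (w t)); apply: le_trans (enormD _ _) _.
by have := oscillation_bound tI; lra.
Qed.
End AprioriBound.

(** Freezing the time variable outside [[0, T]] makes continuity on the strip
    global. *)
Lemma continuous_clamp {R : realType} {n : nat} (T : R)
    (h : R -> 'rV[R]_n -> 'rV[R]_n) : 0 < T ->
  {within `[0, T] `*` [set: 'rV[R]_n], continuous (fun p => h p.1 p.2)} ->
  continuous (fun p : R * 'rV[R]_n => h (Num.max 0 (Num.min p.1 T)) p.2).
Proof.
move=> T0 ch; pose cl (t : R) := Num.max 0 (Num.min t T).
have ccl : continuous cl.
  have lip_min (t s : R) : `|Num.min t T - Num.min s T| <= `|t - s|.
    have := ler_norm (t - s); have := ler_norm (s - t); rewrite (distrC s) => ? ?.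
    rewrite ler_norml; apply/andP.
    by case: (leP t T) => ?; case: (leP s T) => ?; split; lra.
  have lip_max (t s : R) : `|Num.max 0 t - Num.max 0 s| <= `|t - s|.
    have := ler_norm (t - s); have := ler_norm (s - t); rewrite (distrC s) => ? ?.
    rewrite ler_norml; apply/andP.
    by case: (leP 0 t) => ?; case: (leP 0 s) => ?; split; lra.
  apply: (lipschitz_continuous (k := 1)) => // t s; rewrite mul1r.
  exact: le_trans (lip_max _ _) (lip_min _ _).
have clI t : 0 <= cl t <= T.
  by rewrite le_max lexx /= ge_max (ltW T0) ge_min lexx orbT.
pose clp (p : R * 'rV[R]_n) := (cl p.1, p.2).
have cclp : continuous clp.
  apply: continuous_pairing; last by move=> p; exact: cvg_snd.
  by apply: (@continuous_comp_fun _ _ _ (fun p : R * 'rV[R]_n => p.1) cl) => // p; exact: cvg_fst.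
have inA p : (`[0, T] `*` [set: 'rV[R]_n]) (clp p) by split=> //=; rewrite in_itv /= clI.
move=> p B HB; have /subspace_continuousP/(_ _ (inA p) B HB) near_B := ch.
have near_p : \forall r \near p, (`[0, T] `*` [set: 'rV[R]_n]) (clp r) ->
    B (h (clp r).1 (clp r).2) by exact: (@cclp p _ near_B).
by move: near_p; apply: filterS => r; apply; exact: inA.
Qed.

Theorem theorem3p3 (R : realType) (n : nat) (T : R)
  (phi g : 'rV[R]_n -> 'rV[R]_n) (A : 'rV[R]_n -> R)
  (h : R -> 'rV[R]_n -> 'rV[R]_n) (V : 'rV[R]_n -> R) :
  (1 <= n)%N -> 0 < T ->
  homeomorphism phi ->
  {within ~` [set 0], continuous A} ->
  (forall xi, xi != 0 -> 0 < A xi) ->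
  (forall xi, xi != 0 -> phi xi = A xi *: xi) ->
  phi 0 = 0 ->
  {within `[0, T] `*` [set: 'rV[R]_n], continuous (fun p => h p.1 p.2)} ->
  continuous g ->
  (forall y, exists c : R, g y = c *: y) ->
  (exists G : 'rV[R]_n -> R,
     class_C1 G /\ bounded_set (range (fun y => g y - grad G (phi y)))) ->
  class_C2 V ->
  (forall u, V u = 0 -> grad V u != 0) ->
  let D := [set u | V u <= 0] in
  D !=set0 ->
  bounded_set D ->
  (forall t u, t \in `[0, T] -> boundary D u ->
     0 <= dotv (grad V u) (h t u) /\
     (forall y, dotv (grad V u) y = 0 -> 0 <= dotv (y *m hessian V u) y)) ->
  exists x : R -> 'rV[R]_n,
    periodic_solution T phi g h x /\ (forall t, t \in `[0, T] -> D (x t)).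
Proof.
move=> _ T0 [cphi [psi [phiK psiK cpsi]]] _ A_gt0 phiA phi0 ch cg g_par.
move=> [G [G1 gG]] V2 V_reg D D0 bD bnd.
have bdV u : V u = 0 -> boundary D u.
  move=> Vu; split; first by apply: subset_closure; rewrite /D /= Vu.
  move=> /nbhs_dist_ex[e e0 eD].
  have nu0 : 0 < dotv (grad V u) (grad V u) by rewrite dotvv_gt0 // V_reg.
  have e1 : 0 < e / (`|grad V u| + 1) by rewrite divr_gt0 // ltr_wpDl.
  have [s /andP[s0 se] [Vpos _]] := V_increases V2 nu0 Vu e1.
  have : D (u + s *: grad V u).
    apply: eD; rewrite opprD addrA subrr add0r normrN normrZ gtr0_norm //.
    move: se; rewrite ltr_pdivlMr ?ltr_wpDl //; apply: le_lt_trans.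
    by rewrite ler_pM2l // lerDl.
  by rewrite /D /= leNgt Vpos.
have zT : 0 \in `[0, T] by rewrite in_itv /= lexx ltW.
have V_curved u y : V u = 0 -> dotv (grad V u) y = 0 ->
    0 <= dotv (y *m hessian V u) y.
  by move=> /bdV /(bnd 0 u zT)[_]; apply.
have [C [[C0 cC] C_convex CD C_support C_normal]] :=
  convex_component V2 V_reg V_curved D0 bD.
have phi_par y : exists2 k : R, 0 < k & phi y = k *: y.
  have [->|y0] := eqVneq y 0; first by exists 1; rewrite // phi0 scaler0.
  by exists (A y); [exact: A_gt0 | exact: phiA].
have psi_par y : exists2 k : R, 0 < k & psi y = k *: y.
  have [k k0] := phi_par (psi y); rewrite psiK => yE; exists k^-1.
    by rewrite invr_gt0.
  by rewrite [in RHS]yE scalerA mulVf ?scale1r // gt_eqF.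
pose ghat y := g (psi y).
have cghat : continuous ghat := continuous_comp_fun cpsi cg.
have ghat_par y : exists k : R, ghat y = k *: y.
  have [k kE] := g_par (psi y); have [l _ lE] := psi_par y.
  by exists (k * l); rewrite /ghat kE lE scalerA.
have [Bc Bc0 ghatG] : exists2 Bc : R, 0 <= Bc & forall y, enorm (ghat y - grad G y) <= Bc.
  have [M [_ HM]] := gG; exists (n%:R * (`|M| + 1)).
    by rewrite mulr_ge0 // addr_ge0.
  move=> y; apply: le_trans (enorm_le_norm _) _; rewrite ler_wpM2l //.
  apply: HM; first by rewrite (le_lt_trans (ler_norm M)) // ltrDl.
  by exists (psi y) => //=; rewrite /ghat psiK.
pose hc (t : R) y := h (Num.max 0 (Num.min t T)) y.
have chc : continuous (fun p : R * 'rV[R]_n => hc p.1 p.2) := continuous_clamp T0 ch.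
have hcE t y : 0 <= t <= T -> hc t y = h t y.
  by move=> /andP[t0 tT]; rewrite /hc min_l // max_r.
have h_out t p : 0 <= t <= T -> C p -> V p = 0 -> 0 <= dotv (grad V p) (hc t p).
  move=> tI _ /bdV bp; rewrite hcE //.
  by have [] := bnd t p _ bp; rewrite // in_itv.
have [H H0 Hh] : exists2 H : R, 0 < H & forall t p, 0 <= t <= T -> C p -> enorm (hc t p) <= H.
  have cTC : compact (`[0, T]%classic `*` C).
    by apply: compact_setX => //; exact: segment_compact.
  have [H H0 HP] := compact_bound cTC chc; exists (n%:R * H + 1).
    by rewrite ltr_wpDl // mulr_ge0 // ltW.
  move=> t p tI Cp; apply: le_trans (enorm_le_norm _) _.
  apply: (@le_trans _ _ (n%:R * H)); last by rewrite lerDl.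
  by rewrite ler_wpM2l //; apply: (HP (t, p)); split=> //=; rewrite in_itv.
pose c := H + 9 * Bc; pose S := (c * T) ^+ 2 + 1.
have S0 : 0 < S by rewrite ltr_wpDl // sqr_ge0.
have [K gam_le] := truncated_bounded S0 cghat.
have [x [w [Cx [x0T w0T] x_vel w_vel]]] :=
  bounded_problem_solution T0 cphi cpsi phiK psiK phi_par
    (truncated_continuous S0 cghat) (truncated_par S ghat_par) gam_le chc
    C0 cC C_convex C_support C_normal h_out.
have w_le t : 0 <= t <= T -> enorm (w t) <= c * T.
  apply: (momentum_bound S0 ghat_par G1 Bc0 ghatG T0 H0 psi_par x_vel w_vel x0T w0T).
  by move=> s sI; apply: Hh => //; exact: Cx.
exists x; split; last by move=> t; rewrite in_itv /= => /Cx /CD.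
exists (fun t => psi (w t)), (fun t => truncated S ghat (w t) + hc t (x t)).
have cw := velocity_continuous w_vel; have cx := velocity_continuous x_vel.
have phipsi : phi \o (fun t => psi (w t)) = w by apply/funext => t /=.
split=> //; last by rewrite w0T.
- split; first by move=> t tI; exact: velocity_quotient x_vel tI.
  exact: (@continuous_comp_fun (subspace `[0, T]) _ _ w psi).
- rewrite phipsi; split; first by move=> t tI; exact: velocity_quotient w_vel tI.
  apply: continuous_add.
    apply: (@continuous_comp_fun (subspace `[0, T]) _ _ w (truncated S ghat)) => //.
    exact: truncated_continuous.
  have ct : {within `[0, T], continuous (fun t : R => t)}.
    by apply: continuous_subspaceT; exact: continuous_identity.
  have ctx : {within `[0, T], continuous (fun t : R => (t, x t))}.
    exact: (@continuous_pairing (subspace `[0, T]) R 'rV[R]_n (fun t => t) x).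
  exact: (@continuous_comp_fun (subspace `[0, T]) (R * 'rV[R]_n)%type 'rV[R]_n
    (fun t => (t, x t)) (fun p => hc p.1 p.2)).
move=> t; rewrite in_itv /= => tI; rewrite hcE // truncated_id //.
rewrite -sqr_enorm /S; apply: (@le_trans _ _ ((c * T) ^+ 2)); last by rewrite lerDl.
rewrite ler_pXn2r ?nnegrE ?enorm_ge0 ?w_le //.
by apply: le_trans (w_le t tI); exact: enorm_ge0.
Qed.
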